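(* Let $a,b,c\in\mathbb{R}$ and consider the differential system in $\mathbb{R}^3$ $$\dot{x}=a(y-x)+yz,\qquad \dot{y}=bx+cy-xz,\qquad \dot{z}=xy+1.$$ Put $\Delta=(a+b)^2+4ac$, and let $$E_4^\pm=\left(\pm\frac{1}{\sqrt2}\sqrt{-\frac{a+b+\sqrt{\Delta}}{a}},\ \mp\frac{a+b-\sqrt{\Delta}}{2\sqrt2\,c}\sqrt{-\frac{a+b+\sqrt{\Delta}}{a}},\ \frac12\left(-a+b+\sqrt{\Delta}\right)\right),$$ $$E_5^\pm=\left(\pm\frac{1}{\sqrt2}\sqrt{-\frac{a+b-\sqrt{\Delta}}{a}},\ \mp\frac{a+b+\sqrt{\Delta}}{2\sqrt2\,c}\sqrt{-\frac{a+b-\sqrt{\Delta}}{a}},\ \frac12\left(-a+b-\sqrt{\Delta}\right)\right)$$ be its singular points (whenever these expressions are real). (i) If $a=-c$, $c>0$ and $b>3c$, then $E_4^+$ and $E_4^-$ are a pair of Hopf points of the system, which are foci on its center manifold. (ii) If $a=-c$, $c<0$ and $b<3c$, then $E_5^+$ and $E_5^-$ are a pair of Hopf points of the system, which are foci on its center manifold.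
   Context: A singular point of a differential system in $\mathbb{R}^3$ is a Hopf point if the Jacobian matrix of the vector field at that point has a pair of (nonzero) purely imaginary eigenvalues and one nonzero real eigenvalue. At a Hopf point $p$, for every $r\in\mathbb{N}$ there is a (local) invariant two-dimensional manifold $W^c$ of class $\mathcal{C}^r$ through $p$, tangent at $p$ to the plane spanned by the real and imaginary parts of the eigenvectors of the purely imaginary eigenvalues; it is called a center manifold. The singular point $p$ is either a center or a focus for the system restricted to $W^c$. It is a center on the center manifold if all orbits on $W^c$ in a punctured neighborhood of $p$ are periodic orbits surrounding $p$. It is a focus on the center manifold if all orbits on $W^c$ in a punctured neighborhood of $p$ spiral towards $p$ in forward time, or all do so in backward time. *)

(* Defs.v *)
(* Mathematical Components and MathComp-Analysis. *)
From HB Require Import structures.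
From mathcomp Require Import all_boot all_order all_algebra.
From mathcomp Require Import all_classical all_reals all_analysis.
From mathcomp Require Import complex.
Set Implicit Arguments.
Unset Strict Implicit.
Unset Printing Implicit Defensive.
Import Order.TTheory GRing.Theory Num.Theory.
Import numFieldNormedType.Exports.
Local Open Scope classical_set_scope.
Local Open Scope ring_scope.

Section LocalTheory.
Variable R : realType.
Implicit Types (F : 'rV[R]_3 -> 'rV[R]_3) (W U : set 'rV[R]_3).
Implicit Types (p q u v : 'rV[R]_3) (gamma : R -> 'rV[R]_3).

Definition row3 (x y z : R) : 'rV[R]_3 := \row_(i < 3) [:: x; y; z]`_i.

Definition dot u v : R := (u *m v^T) 0 0.

(* 'J F p acts on row vectors (the differential is v |-> v *m 'J F p), so its
   eigenvectors are row eigenvectors, as in the library's eigenspace. *)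
Definition jacobianC F p : 'M[R[i]]_3 := map_mx (real_complex R) ('J F p).

Definition hopf_point F p : Prop :=
  F p = 0 /\
  exists omega lambda : R,
    [/\ omega != 0, lambda != 0,
        eigenvalue (jacobianC F p) (Complex 0 omega),
        eigenvalue (jacobianC F p) (Complex 0 (- omega)) &
        eigenvalue (jacobianC F p) (Complex lambda 0)].

(* At a Hopf point all the eigenvectors w of the two imaginary eigenvalues have
   the same span of real and imaginary parts, so this union of spans is a plane. *)
Definition center_plane F p : set 'rV[R]_3 :=
  [set v | exists (omega : R) (w : 'rV[R[i]]_3),
     [/\ omega != 0,
         (w <= eigenspace (jacobianC F p) (Complex 0 omega))%MS &
         exists s t : R, v = s *: map_mx (@complex.Re R) w
                           + t *: map_mx (@complex.Im R) w]].

(* Only the values of g on the open set U matter. *)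
Fixpoint class_C (r : nat) U (g : 'rV[R]_3 -> R) : Prop :=
  match r with
  | 0 => forall x, U x -> {for x, continuous g}
  | r'.+1 => (forall x, U x -> differentiable g x) /\
             forall v, class_C r' U (fun x => 'D_v g x)
  end.

(* Embedded two-dimensional submanifold of R^3 of class C^r (1 <= r): locally
   the zero set of a C^r function without critical points on it. *)
Definition surface_C (r : nat) W : Prop :=
  forall q, W q -> exists U (g : 'rV[R]_3 -> R),
    [/\ open U, U q, class_C r U g,
        (forall x, U x -> (W x <-> g x = 0)) &
        forall x, U x -> W x -> exists v, 'D_v g x != 0].

Definition tangent_space W p : set 'rV[R]_3 :=
  [set v | exists gamma,
     [/\ gamma 0 = p, (\forall t \near (0 : R), W (gamma t)) &
         is_derive (0 : R) 1 gamma v]].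

(* The derivative is two-sided also at an end point of I; this is no
   restriction, since gamma can be extended differentiably beyond I. *)
Definition solution_on F (I : interval R) gamma : Prop :=
  forall t : R, t \in I -> is_derive t 1 gamma (F (gamma t)).

Definition locally_invariant F W : Prop :=
  forall q, W q -> exists2 T : R, 0 < T & exists gamma,
    [/\ gamma 0 = q, solution_on F `]- T, T[ gamma &
        forall t : R, t \in `]- T, T[ -> W (gamma t)].

Definition center_manifold F p (r : nat) W : Prop :=
  [/\ W p, surface_C r W, locally_invariant F W &
      tangent_space W p = center_plane F p].

(* Orthogonal projection onto the plane spanned by u and v followed by
   q |-> (dot q u, dot q v) is a linear coordinate system of that plane, in
   which rho and theta are polar coordinates centred at p. *)
Definition spirals_to p u v gamma : Prop :=
  gamma t @[t --> +oo] --> p /\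
  exists rho theta : R -> R,
    [/\ forall t, 0 <= t ->
          [/\ 0 < rho t,
              dot (gamma t - p) u = rho t * cos (theta t) &
              dot (gamma t - p) v = rho t * sin (theta t)],
        {within `[0, +oo[, continuous theta} &
        (theta t @[t --> +oo] --> +oo) \/ (theta t @[t --> +oo] --> -oo)].

(* Projection onto the tangent plane is a chart of W near p, and whether the
   angle tends to infinity does not depend on the basis (u, v) of that plane. *)
Definition attracting_focus F p W : Prop :=
  exists u v,
    [/\ tangent_space W p u, tangent_space W p v, row_free (col_mx u v) &
        \forall q \near p, W q -> q <> p -> exists gamma,
          [/\ gamma 0 = q, solution_on F `[0, +oo[ gamma,
              forall t : R, 0 <= t -> W (gamma t) &
              spirals_to p u v gamma]].

(* The orbits of F in backward time are the forward orbits of - F. *)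
Definition focus_on F p W : Prop :=
  attracting_focus F p W \/ attracting_focus (fun q => - F q) p W.

(* A center manifold need not be unique. *)
Definition focus_on_center_manifold F p : Prop :=
  forall (r : nat) W, (0 < r)%N -> center_manifold F p r W -> focus_on F p W.

End LocalTheory.

Section System.
Variables (R : realType) (a b c : R).

Definition field3 (q : 'rV[R]_3) : 'rV[R]_3 :=
  let x := q 0 0 in let y := q 0 1 in let z := q 0 2%:R in
  row3 (a * (y - x) + y * z) (b * x + c * y - x * z) (x * y + 1).

Definition Delta : R := (a + b) ^+ 2 + 4 * a * c.

(* The upper signs correspond to s = 1 and the lower ones to s = -1. A real
   root of a negative number is 0 here; if a root in E4 or E5 has a negative
   argument (and a, c <> 0), the resulting point is not singular: x * y <> -1. *)
Definition E4 (s : R) : 'rV[R]_3 :=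
  let k := Num.sqrt (- ((a + b + Num.sqrt Delta) / a)) in
  row3 (s * (1 / Num.sqrt 2 * k))
       (- s * ((a + b - Num.sqrt Delta) / (2 * Num.sqrt 2 * c) * k))
       (1 / 2 * (- a + b + Num.sqrt Delta)).

Definition E5 (s : R) : 'rV[R]_3 :=
  let k := Num.sqrt (- ((a + b - Num.sqrt Delta) / a)) in
  row3 (s * (1 / Num.sqrt 2 * k))
       (- s * ((a + b + Num.sqrt Delta) / (2 * Num.sqrt 2 * c) * k))
       (1 / 2 * (- a + b - Num.sqrt Delta)).

End System.

(* Main.v *)
Require Import Defs.
From mathcomp Require Import all_boot all_order all_algebra.
From mathcomp Require Import all_classical all_reals all_analysis.
From mathcomp Require Import complex ring lra.

(** When [a = - c] is nonzero, every singular point of the system has the form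
[p = (k, - 1 / k, c (1 + k ^ 2))], with [b = c (1 + k ^ 2 + k ^ (-2))]; the
points of the statement are those with [k ^ 2 > 1]. Around [p] there are linear
coordinates [(D, Z, w)] in which the field reads
[D' = - o Z + ...], [Z' = D + ...], [w' = 2 c w + ...] up to quadratic terms,
where [o = k ^ 2 - k ^ (-2) > 0]. So [p] is a Hopf point with the eigenvalues
[i sqrt o], [- i sqrt o], [2 c], and its center plane is [w = 0].

That [p] is a weak focus is shown without reducing the field to a center
manifold. A polynomial [V = D ^ 2 + o Z ^ 2 + (cubic) + (quartic)] is found
whose derivative along the field of the whole space is
[l (D ^ 2 + o Z ^ 2) ^ 2], up to terms of order five and to terms of order four
divisible by [w] ([cubic_homological], [averaged_rate]). The Lyapunov coefficient
[l = - c ^ 3 al ^ 2 / (2 (o + c ^ 2))] never vanishes and has the sign of [- c].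
An invariant surface [W] tangent to the center plane, even if it is only of
class C^1, satisfies [w = o(|q - p|)] ([surface_tangent_cone]). On [W] all the
error terms are therefore negligible ([lyapunov_estimates]): [V] is comparable
with [|q - p| ^ 2], its derivative with [l V ^ 2], and the angular velocity of
[(D, Z)] is bounded away from zero. After reversing time if [l > 0], [V] decreases.

These inequalities imply that [p] is an attracting focus on [W]
([attracting_focus_criterion]). The invariance of [W] only provides short arcs of
orbits, and small sublevel sets of [V] on [W] are compact and positively
invariant, so the arcs are continued for all positive times
([global_solution]). Along such an orbit [V] tends to [0] without reaching it, and
the polar angle, built as the integral of the angular velocity
([polar_lift]), tends to infinity. *)

Set Implicit Arguments.
Unset Strict Implicit.
Unset Printing Implicit Defensive.
Import Order.TTheory GRing.Theory Num.Theory.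
Import numFieldNormedType.Exports.
Local Open Scope classical_set_scope.
Local Open Scope ring_scope.

(** * Calculus on the real line *)

Section Calculus.
Variable R : realType.
Implicit Types (f g : R -> R) (a b t : R).

Lemma is_derive_cvg (V : normedModType R) (f : R -> V) (t : R) (l : V) :
  is_derive t 1 f l -> {for t, continuous f}.
Proof.
by move=> [df _]; apply: differentiable_continuous; apply/derivable1_diffP.
Qed.

Lemma derive_vecP n (gamma : R -> 'rV[R]_n) (t : R) (v : 'rV[R]_n) :
  is_derive t 1 gamma v <->
  forall i, is_derive t 1 (fun s => gamma s 0 i) (v 0 i).
Proof.
split=> [[dg gv] i|dg].
  split; first by move/derivable_mxP : dg; exact.
  by rewrite -gv derive_mx// mxE.
have d : derivable gamma t 1.
  by apply/derivable_mxP => i j; rewrite (ord1 i); have [] := dg j.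
split=> //; apply/rowP => i; rewrite derive_mx// mxE.
by have [_ ->] := dg i.
Qed.

Lemma derive_le_bound f (f' : R -> R) (C a b : R) : a <= b ->
  (forall t, a <= t <= b -> is_derive t 1 f (f' t)) ->
  (forall t, a <= t <= b -> f' t <= C) -> f b - f a <= C * (b - a).
Proof.
move=> ab df fC.
have [||c cab ->] := @MVT_segment _ f f' a b ab.
- by move=> x; rewrite in_itv/= => /andP[ax xb]; apply: df; rewrite !ltW.
- apply/continuous_in_subspaceT => x; rewrite inE/= in_itv/= => xab.
  exact: is_derive_cvg (df _ xab).
- by rewrite ler_wpM2r ?subr_ge0//; apply: fC; move: cab; rewrite in_itv.
Qed.

Lemma derive_ge_bound (f f' : R -> R) (C a b : R) : a <= b ->
  (forall t, a <= t <= b -> is_derive t 1 f (f' t)) ->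
  (forall t, a <= t <= b -> C <= f' t) -> C * (b - a) <= f b - f a.
Proof.
move=> ab df fC; rewrite -lerN2 opprB addrC -[f a]opprK -mulNr.
have dNf t : a <= t <= b -> is_derive t 1 (fun s => - f s) (- f' t).
  by move=> /df ?; exact: is_deriveN.
by apply: (derive_le_bound ab dNf) => t /fC; rewrite lerN2.
Qed.

Lemma derive0_cst (f : R -> R) (a b : R) : a <= b ->
  (forall t, a <= t <= b -> is_derive t 1 f 0) -> f b = f a.
Proof.
move=> ab df; apply/eqP; rewrite -subr_eq0 eq_le.
have := derive_le_bound (C := 0) ab df; rewrite mul0r => ->//.
by have := derive_ge_bound (C := 0) ab df; rewrite mul0r => ->.
Qed.

Lemma derive_add f g (t a b : R) : is_derive t 1 f a -> is_derive t 1 g b ->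
  is_derive t 1 (fun s => f s + g s) (a + b).
Proof. exact: is_deriveD. Qed.

Lemma derive_sub f g (t a b : R) : is_derive t 1 f a -> is_derive t 1 g b ->
  is_derive t 1 (fun s => f s - g s) (a - b).
Proof. exact: is_deriveB. Qed.

Lemma derive_mul f g (t a b : R) : is_derive t 1 f a -> is_derive t 1 g b ->
  is_derive t 1 (fun s => f s * g s) (a * g t + f t * b).
Proof.
move=> df dg; apply: is_derive_eq (is_deriveM df dg) _.
by rewrite addrC [_ *: _]mulrC.
Qed.

Lemma derive_scale f (k t a : R) : is_derive t 1 f a ->
  is_derive t 1 (fun s => k * f s) (k * a).
Proof. exact: is_deriveZ. Qed.

(** At a point where only continuity is known, the derivative is recovered as
the limit of the derivatives at nearby points, by the mean value theorem. *)
Lemma is_derive_of_limit f (g : R -> R) a :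
  {for a, continuous f} -> {for a, continuous g} ->
  (\forall t \near a, t != a -> is_derive t 1 f (g t)) ->
  is_derive a 1 f (g a).
Proof.
move=> cf cg /nbhs_ballP[d d0 df].
suff h : h^-1 *: ((f \o shift a) (h *: 1) - f a) @[h --> 0^'] --> g a.
  by split; [apply/cvg_ex; exists (g a) | apply/cvg_lim].
apply/cvgrPdist_le => /= e e0.
have /nbhs_ballP[r r0 gr] : \forall t \near a, `|g a - g t| <= e.
  by move/cvgrPdist_le: cg; exact.
exists (Num.min d r); first by rewrite /= lt_min; apply/andP.
move=> h; rewrite /ball_/= sub0r normrN lt_min => /andP[hd hr] h0.
rewrite [h *: 1]mulr1 /shift /=.
have cont x : `|x - a| < d -> {for x, continuous f}.
  move=> xd; have [->//|xa] := eqVneq x a.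
  by apply: is_derive_cvg (df _ _ xa); rewrite /ball/= distrC.
suff [c [cr ->]] : exists c, `|c - a| < r /\ f (h + a) - f a = g c * h.
  rewrite [_ *: _]mulrC mulfK//; apply: gr.
  by rewrite /ball/= distrC.
have dd x y : `|x - a| < d -> `|y - a| < d -> forall z, x <= z <= y ->
    `|z - a| < d.
  rewrite !ltr_norml => /andP[? ?] /andP[? ?] z /andP[? ?].
  by rewrite ltr_norml; apply/andP; split; lra.
have [hp|hn|h00] := ltgtP 0 h; last by rewrite h00 eqxx in h0.
- have a1 : `|a - a| < d by rewrite subrr normr0.
  have a2 : `|h + a - a| < d by rewrite addrK.
  have [||| c cI ->] := @MVT _ f g a (h + a).
  + lra.
  + move=> x; rewrite in_itv/= => /andP[xa xh]; apply: df.
      by rewrite /ball/= distrC; apply: (dd a (h + a)) => //; rewrite !ltW.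
    by rewrite gt_eqF.
  + apply/continuous_in_subspaceT => x; rewrite inE/= in_itv/= => xab.
    by apply: cont; apply: (dd a (h + a)).
  exists c; rewrite addrK; split => //.
  move: cI hr; rewrite in_itv/= => /andP[? ?]; rewrite !ltr_norml => /andP[? ?].
  by apply/andP; split; lra.
- have a1 : `|a - a| < d by rewrite subrr normr0.
  have a2 : `|h + a - a| < d by rewrite addrK.
  have [||| c cI E] := @MVT _ f g (h + a) a.
  + lra.
  + move=> x; rewrite in_itv/= => /andP[xa xh]; apply: df.
      by rewrite /ball/= distrC; apply: (dd (h + a) a) => //; rewrite !ltW.
    by rewrite lt_eqF.
  + apply/continuous_in_subspaceT => x; rewrite inE/= in_itv/= => xab.
    by apply: cont; apply: (dd (h + a) a).
  exists c; split; last by lra.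
  move: cI hr; rewrite in_itv/= => /andP[? ?]; rewrite !ltr_norml => /andP[? ?].
  by apply/andP; split; lra.
Qed.

Lemma near_norm (V : normedModType R) (x : V) (e : R) (P : set V) : 0 < e ->
  (forall y, `|y - x| < e -> P y) -> \forall y \near x, P y.
Proof.
move=> e0 h; apply/nbhs_ballP; exists e => // y.
by rewrite -ball_normE /ball_/= distrC; exact: h.
Qed.

End Calculus.

(** * Solutions with values in a compact set *)

Section Flow.
Variable R : realType.
Implicit Types (f : R -> R) (F : 'rV[R]_3 -> 'rV[R]_3) (K : set 'rV[R]_3).
Implicit Types (gamma : R -> 'rV[R]_3) (q : 'rV[R]_3).

Lemma gronwall f (f' : R -> R) (M a b : R) : a <= b ->
  (forall t, a <= t <= b -> is_derive t 1 f (f' t)) ->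
  (forall t, a <= t <= b -> f' t <= M * f t) ->
  f b <= f a * expR (M * (b - a)).
Proof.
move=> ab df fM.
pose g t := f t * expR (- M * (t - a)).
have dg t : a <= t <= b ->
    is_derive t 1 g ((f' t - M * f t) * expR (- M * (t - a))).
  move=> /df dft.
  have de : is_derive t 1 (expR \o (fun t => - M * (t - a)))
      (expR (- M * (t - a)) * - M).
    apply: is_derive1_comp.
    rewrite -[X in is_derive _ _ _ X]mulr1; apply: is_deriveZ.
    rewrite -[1 in X in is_derive _ _ _ X]subr0; exact: is_deriveB.
  apply: is_derive_eq; rewrite /GRing.scale/=; ring.
have := derive_le_bound ab dg (C := 0) _.
rewrite mul0r subr_le0 /g subrr mulr0 expR0 mulr1 => h.
have {}h : f b * expR (- M * (b - a)) <= f a.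
  by apply: h => t /fM ft; rewrite pmulr_lle0 ?expR_gt0// subr_le0.
by rewrite -ler_pdivrMr ?expR_gt0// -expRN -mulNr.
Qed.

Lemma coord_le_norm n (v : 'rV[R]_n) i : `|v 0 i| <= `|v|.
Proof.
rewrite [leRHS]/Num.Def.normr /= mx_normrE.
exact: (le_bigmax _ (fun ij : 'I_1 * 'I_n => `|v ij.1 ij.2|) (0, i)).
Qed.

Lemma norm_le_coord n (v : 'rV[R]_n) (C : R) : 0 <= C ->
  (forall i, `|v 0 i| <= C) -> `|v| <= C.
Proof.
move=> C0 h; rewrite [leLHS]/Num.Def.normr /= mx_normrE.
by apply/bigmax_le => // -[i j] _ /=; rewrite (ord1 i).
Qed.

Lemma solution_lipschitz F gamma (B a b : R) : a <= b ->
  (forall t, a <= t <= b -> is_derive t 1 gamma (F (gamma t))) ->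
  (forall t, a <= t <= b -> `|F (gamma t)| <= B) ->
  `|gamma b - gamma a| <= B * (b - a).
Proof.
move=> ab dg gB.
have B0 : 0 <= B by apply: le_trans (gB a _); rewrite ?lexx.
apply: norm_le_coord => [|i]; first by rewrite mulr_ge0// subr_ge0.
rewrite !mxE ler_norml.
have d1 t : a <= t <= b -> is_derive t 1 (fun s => gamma s 0 i) (F (gamma t) 0 i).
  by move=> /dg /derive_vecP.
have bd t : a <= t <= b -> `|F (gamma t) 0 i| <= B.
  by move=> tab; apply: le_trans (coord_le_norm _ _) (gB _ tab).
rewrite -mulNr; apply/andP; split.
  apply: (derive_ge_bound ab d1) => t tab.
  by have := bd t tab; rewrite ler_norml => /andP[].
apply: (derive_le_bound ab d1) => t tab.
exact: le_trans (ler_norm _) (bd _ tab).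
Qed.

(** Gronwall's inequality for the squared Euclidean distance of two solutions,
which is differentiable, unlike the norm of row vectors. *)
Lemma solution_unique F K (L T : R) gamma1 gamma2 : 0 <= L ->
  (forall q q', K q -> K q' -> `|F q - F q'| <= L * `|q - q'|) ->
  gamma1 0 = gamma2 0 ->
  (forall t, 0 <= t < T -> is_derive t 1 gamma1 (F (gamma1 t)) /\ K (gamma1 t)) ->
  (forall t, 0 <= t < T -> is_derive t 1 gamma2 (F (gamma2 t)) /\ K (gamma2 t)) ->
  forall t, 0 <= t < T -> gamma1 t = gamma2 t.
Proof.
move=> L0 KL g0 s1 s2 t /andP[t0 tT].
pose d s i := gamma1 s 0 i - gamma2 s 0 i.
pose d' s i := F (gamma1 s) 0 i - F (gamma2 s) 0 i.
pose E := \sum_(i < 3) (d^~ i : R -> R) ^+ 2.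
have EE s : E s = \sum_(i < 3) d s i ^+ 2 by rewrite /E fct_sumE.
have dE s : 0 <= s <= t -> is_derive s 1 E (\sum_(i < 3) 2 * d s i * d' s i).
  move=> /andP[s0 st].
  have sT : 0 <= s < T by rewrite s0 (le_lt_trans st).
  have [/derive_vecP d1 _] := s1 _ sT; have [/derive_vecP d2 _] := s2 _ sT.
  have dd i : is_derive s 1 (d^~ i) (d' s i).
    exact: (is_deriveB (df := F (gamma1 s) 0 i) (dg := F (gamma2 s) 0 i)).
  apply: is_derive_eq; apply: eq_bigr => i _.
  by rewrite /GRing.scale/= expr1.
have dle s : 0 <= s <= t -> \sum_(i < 3) 2 * d s i * d' s i <= 6 * L * E s.
  move=> /andP[s0 st].
  have sT : 0 <= s < T by rewrite s0 (le_lt_trans st).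
  have [_ K1] := s1 _ sT; have [_ K2] := s2 _ sT.
  have LD := KL _ _ K1 K2.
  set N := `|gamma1 s - gamma2 s| in LD.
  have N0 : 0 <= N by exact: normr_ge0.
  have dN i : `|d s i| <= N.
    by have := coord_le_norm (gamma1 s - gamma2 s) i; rewrite !mxE.
  have d'N i : `|d' s i| <= L * N.
    have := le_trans (coord_le_norm (F (gamma1 s) - F (gamma2 s)) i) LD.
    by rewrite !mxE.
  have NE : N ^+ 2 <= E s.
    have [->|/mx_norm_neq0[[i j] /= Ni]] := eqVneq N 0.
      by rewrite expr0n EE /=; apply: sumr_ge0 => i _; rewrite sqr_ge0.
    rewrite EE (bigD1 j)//= -[leLHS]addr0 lerD//.
      rewrite -[leRHS]real_normK ?num_real//; rewrite /N [X in X ^+ _ <= _]Ni.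
      by rewrite (ord1 i) !mxE.
    by apply: sumr_ge0 => k _; rewrite sqr_ge0.
  have h i : 2 * d s i * d' s i <= 2 * L * N ^+ 2.
    rewrite -!mulrA ler_pM2l//; apply: le_trans (ler_norm _) _.
    rewrite normrM (_ : L * N ^+ 2 = N * (L * N)); last ring.
    exact: ler_pM.
  apply: (@le_trans _ _ (\sum_(i < 3) 2 * L * N ^+ 2)); first exact: ler_sum.
  rewrite sumr_const card_ord -[leLHS]mulr_natl.
  rewrite (_ : 3%:R * _ = 6 * L * N ^+ 2); last ring.
  by rewrite ler_wpM2l ?mulr_ge0.
have Et : E t <= 0.
  apply: le_trans (gronwall t0 dE dle) _.
  by rewrite EE big1 ?mul0r// => i _; rewrite /d g0 subrr expr0n.
apply/rowP => i; apply/eqP; rewrite -subr_eq0 -sqrf_eq0 eq_le sqr_ge0 andbT.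
apply: le_trans Et; rewrite EE (bigD1 i)//= lerDl.
by apply: sumr_ge0 => k _; rewrite sqr_ge0.
Qed.

End Flow.

Section GlobalSolution.
Variable R : realType.
Variables (F : 'rV[R]_3 -> 'rV[R]_3) (K : set 'rV[R]_3) (B L : R).
Implicit Types (gamma : R -> 'rV[R]_3) (q : 'rV[R]_3).
Hypothesis L0 : 0 <= L.
Hypothesis closedK : closed K.
Hypothesis KB : forall q, K q -> `|F q| <= B.
Hypothesis KL : forall q q', K q -> K q' -> `|F q - F q'| <= L * `|q - q'|.
Hypothesis contF : continuous F.
Hypothesis local_solution : forall q, K q -> exists2 T : R, 0 < T &
  exists gamma, [/\ gamma 0 = q,
    forall t, 0 <= t < T -> is_derive t 1 gamma (F (gamma t)) &
    forall t, 0 <= t < T -> K (gamma t)].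

Let sol (T : R) gamma :=
  forall t : R, 0 <= t < T -> is_derive t 1 gamma (F (gamma t)) /\ K (gamma t).

(** A solution with values in [K] has speed at most [B], so it satisfies the
Cauchy criterion at the end of a bounded interval. *)
Lemma solution_limit (T : R) gamma : 0 < T -> sol T gamma ->
  exists2 q, K q & forall t, 0 <= t < T -> `|gamma t - q| <= B * (T - t).
Proof.
move=> T0 s.
have lip a b : 0 <= a -> a <= b -> b < T -> `|gamma b - gamma a| <= B * (b - a).
  move=> a0 ab bT; apply: (solution_lipschitz (F := F)) => // t /andP[at_ tb];
    by have [] := s t _; rewrite ?(le_trans a0) ?(le_lt_trans tb)//; auto.
have [_ K0] : is_derive (0 : R) 1 gamma (F (gamma 0)) /\ K (gamma 0).
  by apply: s; rewrite lexx.
have B0 : 0 <= B by apply: le_trans (KB K0); rewrite normr_ge0.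
have nearT a : a < T -> \forall t \near T^'-, a <= t < T.
  move=> aT; near=> t; apply/andP; split => //.
  by near: t; exact: nbhs_left_ge.
have cauchy_g : cauchy (gamma t @[t --> T^'-]).
  apply: cauchy_exP => e e0.
  pose a := Num.max 0 (T - e / (B + 1)).
  have B1 : 0 < B + 1 by lra.
  have aT : a < T by rewrite gt_max T0 ltrBlDr ltrDl divr_gt0.
  exists (gamma a); rewrite /= near_simpl.
  near=> t; have /andP[at_ tT] : a <= t < T by near: t; exact: nearT.
  rewrite /= -ball_normE /ball_ /= distrC.
  apply: le_lt_trans (lip a t _ at_ tT) _; first by rewrite le_max lexx.
  have : t - a < e / (B + 1).
    have : T - e / (B + 1) <= a by rewrite le_max lexx orbT.
    lra.
  rewrite ltr_pdivlMr// => h; apply: le_lt_trans h.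
  by rewrite mulrC ler_wpM2l ?subr_ge0// lerDl.
have /cvg_ex[/= q gq] : cvg (gamma t @[t --> T^'-]) by exact/cauchy_cvgP.
exists q.
  apply: (closed_cvg _ closedK _ _ gq) => //.
  near=> t; have /andP[? ?] : 0 <= t < T by near: t; exact: nearT.
  by have [] := s t _ => //; apply/andP.
move=> t /andP[t0 tT].
have cn : `|gamma t - gamma s| @[s --> T^'-] --> `|gamma t - q|.
  by apply: cvg_norm; apply: cvgB => //; exact: cvg_cst.
apply: (@ler_cvg_to _ _ _ _ _ _ _ _ cn (cvg_cst (B * (T - t)))).
near=> u; have /andP[tu uT] : t <= u < T by near: u; exact: nearT.
rewrite distrC; apply: le_trans (lip t u t0 tu uT) _.
by rewrite ler_wpM2l// lerB// ltW.
Unshelve. all: by end_near. Qed.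

(** The piece of solution that starts at the limit point prolongs the given
one; at the junction the derivative is the limit of the nearby derivatives. *)
Lemma solution_extend (T : R) gamma : 0 < T -> sol T gamma ->
  exists T' gamma', [/\ T < T', gamma' 0 = gamma 0 & sol T' gamma'].
Proof.
move=> T0 s; have [q Kq gq] := solution_limit T0 s.
have B0 : 0 <= B by apply: le_trans (KB Kq); rewrite normr_ge0.
have [T1 T10 [phi [phi0 dphi Kphi]]] := local_solution Kq.
pose g t := if t < T then gamma t else phi (t - T).
exists (T + T1), g; split; first by lra.
  by rewrite /g T0.
have dshift t : T <= t < T + T1 ->
    is_derive t 1 (fun u => phi (u - T)) (F (phi (t - T))).
  move=> /andP[tT tT1].
  have tI : 0 <= t - T < T1 by apply/andP; split; lra.
  have /derive_vecP dp := dphi _ tI.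
  apply/derive_vecP => i.
  have ds : is_derive t 1 (fun u : R => u - T) 1.
    by rewrite -[1 in X in is_derive _ _ _ X]subr0; exact: is_deriveB.
  rewrite -[X in is_derive _ _ _ X]mulr1.
  exact: (@is_derive1_comp _ (fun u => phi u 0 i) (fun u => u - T)).
have gT : g T = q by rewrite /g ltxx subrr phi0.
have cg : {for T, continuous g}.
  apply/cvgrPdist_le => e e0; rewrite gT.
  have cphi : {for T, continuous (fun u => phi (u - T))}.
    by apply: is_derive_cvg (dshift T _); rewrite lexx ltrDl.
  move/cvgrPdist_le : cphi => /(_ _ e0); rewrite subrr phi0 => -[d /= d0 hd].
  have B1 : 0 < B + 1 by lra.
  apply: (@near_norm _ R^o _ (Num.min (Num.min d T) (e / (B + 1)))).
    by rewrite !lt_min d0 T0 divr_gt0.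
  move=> u; rewrite !lt_min => /andP[/andP[ud uT] ue].
  rewrite /g; case: ltP => [uT'|Tu].
    rewrite distrC; apply: le_trans (gq u _) _.
      by move: uT; rewrite ltr_norml => /andP[? ?]; apply/andP; split; lra.
    rewrite distrC gtr0_norm ?subr_gt0// ltr_pdivlMr// in ue.
    apply: le_trans (ltW ue); rewrite mulrC ler_wpM2l ?lerDl//.
    by rewrite subr_ge0 ltW.
  by apply: hd; rewrite /ball_/= distrC.
have dg t : 0 <= t < T + T1 -> t != T -> is_derive t 1 g (F (g t)).
  move=> /andP[t0 tT1] tT.
  have [ltT|ltT|] := ltgtP t T; last by move=> E; rewrite E eqxx in tT.
    have [d _] : is_derive t 1 gamma (F (gamma t)) /\ K (gamma t).
      by apply: s; rewrite t0.
    rewrite /g ltT; apply: near_eq_is_derive d.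
    apply: (@near_norm _ R^o _ (T - t)); first by rewrite subr_gt0.
    move=> u; rewrite ltr_norml => /andP[_ h].
    by rewrite /g ifT//; lra.
  have d : is_derive t 1 (fun u => phi (u - T)) (F (phi (t - T))).
    by apply: dshift; rewrite ltW.
  rewrite {2}/g ltNge ltW//=; apply: near_eq_is_derive d.
  apply: (@near_norm _ R^o _ (t - T)); first by rewrite subr_gt0.
  move=> u; rewrite ltr_norml => /andP[h _].
  by rewrite /g ifF//; apply/negbTE; rewrite -leNgt; lra.
move=> t /andP[t0 tT1]; split; last first.
  rewrite /g; case: ltP => tT; first by have [] := s t _; rewrite ?t0.
  by apply: Kphi; apply/andP; split; lra.
have [->|tT] := eqVneq t T; last by apply: dg => //; rewrite t0.
apply/derive_vecP => i.
have cF : {for T, continuous (fun u => F (g u))}.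
  by apply: continuous_comp => //; exact: contF.
apply: (@is_derive_of_limit _ (fun u => g u 0 i) (fun u => F (g u) 0 i)).
- exact: continuous_comp cg (@coord_continuous _ _ _ 0 i _).
- exact: continuous_comp cF (@coord_continuous _ _ _ 0 i _).
- apply: (@near_norm _ R^o _ (Num.min T T1)); first by rewrite lt_min T0.
  move=> u; rewrite lt_min !ltr_norml => /andP[/andP[h1 h2] /andP[h3 h4]] uT.
  suff /derive_vecP : is_derive u 1 g (F (g u)) by exact.
  by apply: dg => //; apply/andP; split; lra.
Qed.

(** By uniqueness the solutions on bounded intervals fit together, and the
extension property leaves no room for a finite maximal time. *)
Lemma global_solution q : K q -> exists gamma,
  [/\ gamma 0 = q, solution_on F `[0, +oo[ gamma &
      forall t : R, 0 <= t -> K (gamma t)].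
Proof.
move=> Kq.
pose J : set R := [set t | exists T gamma, [/\ t < T, gamma 0 = q & sol T gamma]].
have /choice[g gJ] t : exists gamma, J t ->
    exists T, [/\ t < T, gamma 0 = q & sol T gamma].
  have [[T [gamma h]]|nJ] := pselect (J t).
    by exists gamma => _; exists T.
  by exists (fun=> q).
have J0 : exists2 T, 0 < T & forall t, t < T -> J t.
  have [T T0 [gamma [g0 dg Kg]]] := local_solution Kq.
  exists T => // t tT; exists T, gamma; split => // u uT.
  by split; [exact: dg|exact: Kg].
have Jdown t u : t <= u -> J u -> J t.
  by move=> tu [T [gamma [uT g0 h]]]; exists T, gamma; rewrite (le_lt_trans tu).
pose gamma t := g (Num.max 0 t) t.
have g0 : gamma 0 = q.
  rewrite /gamma maxxx; have [T T0 TJ] := J0.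
  by have [T' [_ -> _]] := gJ 0 (TJ _ T0).
have agree t T1 u : g t 0 = q -> sol T1 (g t) -> 0 <= u < T1 -> g t u = g u u.
  move=> gt0 s1 /andP[u0 uT1].
  have Ju : J u by exists T1, (g t).
  have [T2 [uT2 gu0 s2]] := gJ u Ju.
  apply: (@solution_unique _ F K L (Num.min T1 T2)) => //.
  - by rewrite gt0 gu0.
  - move=> x; rewrite lt_min => /and3P[x0 x1 x2]; apply: s1; exact/andP.
  - move=> x; rewrite lt_min => /and3P[x0 x1 x2]; apply: s2; exact/andP.
  - by rewrite u0 lt_min uT1 uT2.
have sJ t : J t -> 0 <= t -> is_derive t 1 gamma (F (gamma t)) /\ K (gamma t).
  move=> Jt t0; have [T1 [tT1 gt0 s1]] := gJ t Jt.
  have [d Kd] := s1 t (introT andP (conj t0 tT1)).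
  have E : gamma t = g t t by rewrite /gamma max_r.
  rewrite E; split => //; apply: near_eq_is_derive d.
  have [tp|tn] := ltP 0 t.
    apply: (@near_norm _ R^o _ (Num.min t (T1 - t))); first by rewrite lt_min tp subr_gt0.
    move=> u; rewrite lt_min !ltr_norml => /andP[/andP[h1 h2] /andP[h3 h4]].
    have u0 : 0 <= u by lra.
    rewrite /gamma max_r//; apply: (agree _ T1) => //.
    by rewrite u0; lra.
  have t00 : t = 0 by apply/eqP; rewrite eq_le tn.
  subst t; apply: (@near_norm _ R^o _ T1) => // u.
  rewrite subr0 ltr_norml => /andP[h1 h2]; rewrite /gamma.
  have [u0|u0] := leP 0 u; last by [].
  by apply: (agree _ T1) => //; rewrite u0.
have JT t : J t.
  apply: contrapT => nJt.
  have hub : has_ubound J.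
    exists t => u Ju; rewrite leNgt; apply/negP => tu; apply: nJt.
    by apply: Jdown Ju; exact: ltW.
  have [T T0 TJ] := J0.
  have J00 : J 0 by exact: TJ.
  have hs : has_sup J by split => //; exists 0.
  have Jlt u : u < sup J -> J u.
    move=> uJ; have := sup_adherent (eps := sup J - u) _ hs.
    rewrite subr_gt0 => /(_ uJ) [x Jx]; rewrite subKr => ux.
    by apply: Jdown Jx; exact: ltW.
  have s0 : 0 < sup J.
    apply: (@lt_le_trans _ _ (T / 2)); first by lra.
    by apply: sup_upper_bound => //; apply: TJ; lra.
  have ss : sol (sup J) gamma by move=> u /andP[u0 uJ]; apply: sJ => //; exact: Jlt.
  have [T' [gamma' [sT' g'0 s']]] := solution_extend s0 ss.
  have : J ((sup J + T') / 2).
    exists T', gamma'; split => //; first by lra.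
    by rewrite g'0.
  by move=> /(sup_upper_bound hs); lra.
exists gamma; split => // t.
  by rewrite in_itv/= andbT => t0; have [] := sJ t (JT t) t0.
by move=> t0; have [] := sJ t (JT t) t0.
Qed.

End GlobalSolution.

(** * Polar coordinates along a curve *)

Section PolarAngle.
Variable R : realType.
Implicit Types (X Y : R -> R).

(** The integrand is frozen at its value at [0] for negative times, which makes
it continuous on the whole line and its primitive differentiable at [0]. *)
Lemma continuous_primitive (r : R -> R) : (forall t : R, 0 <= t -> {for t, continuous r}) ->
  exists theta : R -> R, theta 0 = 0 /\
    forall t : R, 0 <= t -> is_derive t 1 theta (r t).
Proof.
move=> cr.
pose r' t := r (Num.max 0 t).
have cr' : continuous r'.
  move=> t; apply: continuous_comp; last by apply: cr; rewrite le_max lexx.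
  apply: (@continuous_max _ _ (fun=> 0) id); first exact: cvg_cst.
  exact: cvg_id.
pose I t := parameterized_integral (@lebesgue_measure R) (-1) t r'.
exists (fun t => I t - I 0); split; first by rewrite subrr.
move=> t t0.
have -> : r t = r' t by rewrite /r' max_r.
rewrite -[r' t]subr0; apply: is_deriveB.
have tt1 : t < t + 1 by lra.
have t1 : -1 < t by lra.
have ri : (@lebesgue_measure R).-integrable `[-1, t + 1] (EFin \o r').
  apply: continuous_compact_integrable; first exact: segment_compact.
  exact: continuous_subspaceT.
have [d e] := continuous_FTC1_closed tt1 ri t1 (cr' t).
by split; [exact: d | rewrite -derive1E; exact: e].
Qed.

Lemma unit_circle_angle (x y : R) : x ^+ 2 + y ^+ 2 = 1 ->
  exists t, x = cos t /\ y = sin t.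
Proof.
move=> xy.
have x1 : -1 <= x <= 1.
  rewrite -ler_norml -(expr_le1 (n := 2))//.
  by rewrite real_normK ?num_real// -xy lerDl sqr_ge0.
have sy : sin (acos x) = `|y|.
  by rewrite sin_acos// -xy [X in X - _]addrC addrK sqrtr_sqr.
have [y0|y0] := leP 0 y.
  by exists (acos x); rewrite acosK ?in_itv//= sy ger0_norm.
exists (- acos x); rewrite cosN sinN acosK ?in_itv//= sy ltr0_norm//.
by rewrite opprK.
Qed.

(** The angle is the integral of the angular velocity: with [rho] the radius,
the scalar product of the unit vectors [(X, Y) / rho] and
[(cos theta, sin theta)] has zero derivative, hence stays equal to one. *)
Lemma polar_lift (X Y X' Y' : R -> R) (kappa : R) : 0 < kappa ->
  (forall t : R, 0 <= t -> is_derive t 1 X (X' t)) ->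
  (forall t : R, 0 <= t -> is_derive t 1 Y (Y' t)) ->
  (forall t : R, 0 <= t -> {for t, continuous X'}) ->
  (forall t : R, 0 <= t -> {for t, continuous Y'}) ->
  (forall t : R, 0 <= t -> 0 < X t ^+ 2 + Y t ^+ 2) ->
  (forall t : R, 0 <= t ->
     kappa * (X t ^+ 2 + Y t ^+ 2) <= X t * Y' t - Y t * X' t) ->
  exists rho theta : R -> R,
    [/\ forall t : R, 0 <= t ->
          [/\ 0 < rho t, X t = rho t * cos (theta t) &
              Y t = rho t * sin (theta t)],
        {within `[0, +oo[, continuous theta} &
        theta t @[t --> +oo] --> +oo].
Proof.
move=> k0 dX dY cX' cY' N0 kN.
pose N := (X ^+ 2 + Y ^+ 2 : R -> R).
have NE t : N t = X t ^+ 2 + Y t ^+ 2 by [].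
pose r t := (X t * Y' t - Y t * X' t) / N t.
have cX t : 0 <= t -> {for t, continuous X} by move=> /dX; exact: is_derive_cvg.
have cY t : 0 <= t -> {for t, continuous Y} by move=> /dY; exact: is_derive_cvg.
have cr t : 0 <= t -> {for t, continuous r}.
  move=> t0; apply: cvgM.
    apply: cvgB; apply: cvgM; [exact: cX|exact: cY'|exact: cY|exact: cX'].
  apply: cvgV; first by rewrite gt_eqF// NE N0.
  apply: cvgD; rewrite !expr2; apply: cvgM; by [exact: cX|exact: cY].
have [Th [Th0 dTh]] := continuous_primitive cr.
have rho0 t : 0 <= t -> 0 < Num.sqrt (N t) by move=> /N0; rewrite sqrtr_gt0.
have sqN t : 0 <= t -> Num.sqrt (N t) ^+ 2 = X t ^+ 2 + Y t ^+ 2.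
  by move=> /N0/ltW/sqr_sqrtr.
have [th0 [c0 sn0]] : exists th, X 0 / Num.sqrt (N 0) = cos th /\
    Y 0 / Num.sqrt (N 0) = sin th.
  apply: unit_circle_angle; rewrite !expr_div_n -mulrDl sqN// divff//.
  by rewrite gt_eqF// N0.
pose th t := th0 + Th t.
have dth (t : R) : 0 <= t -> is_derive t 1 th (r t).
  by move=> /dTh d; rewrite -[r t]add0r; exact: is_deriveD.
exists (fun t => Num.sqrt (N t)), th; split.
- move=> t t0.
  pose Q : R -> R := (X * (cos \o th) + Y * (sin \o th)) *
              (fun t => (Num.sqrt (N t))^-1).
  have dQ (s : R) : 0 <= s <= t -> is_derive s 1 Q 0.
    move=> /andP[s0 _].
    have d3 := dth _ s0.
    have p := rho0 _ s0; have n0 := N0 _ s0; have E2 := sqN _ s0.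
    have dN : is_derive s 1 N (2 * (X s * X' s + Y s * Y' s)).
      have d := derive_add (derive_mul (dX _ s0) (dX _ s0))
                           (derive_mul (dY _ s0) (dY _ s0)).
      by apply: is_derive_eq d _; ring.
    have Ns : 0 < N s by exact: n0.
    have d4 := @is_derive1_comp _ Num.sqrt N s _ _ (is_derive1_sqrt Ns) dN.
    have d5 := @is_deriveV _ (Num.sqrt \o N) s _ 1 (lt0r_neq0 p) d4.
    have d6 := @is_derive1_comp _ cos th s _ _ (is_derive_cos _) d3.
    have d7 := @is_derive1_comp _ sin th s _ _ (is_derive_sin _) d3.
    have d := derive_mul (derive_add (derive_mul (dX _ s0) d6)
                                     (derive_mul (dY _ s0) d7)) d5.
    apply: is_derive_eq d _; rewrite /GRing.scale/=.
    move: E2 p; rewrite /r; set w := Num.sqrt _ => E2 p.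
    rewrite (NE s) -E2.
    set c := cos _; set sn := sin _.
    have w0 : w != 0 by rewrite gt_eqF.
    transitivity ((X s ^+ 2 + Y s ^+ 2 - w ^+ 2) * (X' s * c + Y' s * sn) *
       (- (w ^+ 3)^-1)); last by rewrite E2 subrr !mul0r.
    by field.
  have Q1 : Q t = 1.
    rewrite (derive0_cst t0 dQ).
    have -> : Q 0 = (X 0 * cos (th 0) + Y 0 * sin (th 0)) / Num.sqrt (N 0) by [].
    rewrite /th Th0 addr0 -c0 -sn0.
    have p := rho0 0 (lexx 0).
    have -> : (X 0 * (X 0 / Num.sqrt (N 0)) + Y 0 * (Y 0 / Num.sqrt (N 0))) /
      Num.sqrt (N 0) = (X 0 ^+ 2 + Y 0 ^+ 2) / Num.sqrt (N 0) ^+ 2.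
      by field; rewrite gt_eqF.
    by rewrite sqN// divff// gt_eqF// N0.
  have p := rho0 t t0; have E2 := sqN t t0.
  have {}Q1 : (X t * cos (th t) + Y t * sin (th t)) / Num.sqrt (N t) = 1 by [].
  have {}Q1 : X t * cos (th t) + Y t * sin (th t) = Num.sqrt (N t).
    by apply: (mulIf (x := (Num.sqrt (N t))^-1));
      rewrite ?Q1 ?divff ?invr_eq0 ?gt_eqF.
  have sq0 : (X t - Num.sqrt (N t) * cos (th t)) ^+ 2 +
             (Y t - Num.sqrt (N t) * sin (th t)) ^+ 2 = 0.
    have cs := cos2Dsin2 (th t).
    transitivity ((X t ^+ 2 + Y t ^+ 2) - 2 * Num.sqrt (N t) *
      (X t * cos (th t) + Y t * sin (th t)) +
      Num.sqrt (N t) ^+ 2 * (cos (th t) ^+ 2 + sin (th t) ^+ 2)); first ring.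
    by rewrite Q1 cs -E2; ring.
  have /andP[] : ((X t - Num.sqrt (N t) * cos (th t)) ^+ 2 == 0) &&
             ((Y t - Num.sqrt (N t) * sin (th t)) ^+ 2 == 0).
    by rewrite -paddr_eq0 ?sqr_ge0// sq0.
  by rewrite !sqrf_eq0 !subr_eq0 => /eqP-> /eqP->.
- apply: continuous_in_subspaceT => t; rewrite inE/= in_itv/= andbT => t0.
  exact: is_derive_cvg (dth _ t0).
- have thk (t : R) : 0 <= t -> th 0 + kappa * t <= th t.
    move=> t0; rewrite -lerBrDl -[X in kappa * X]subr0.
    apply: (@derive_ge_bound _ th r) => // s /andP[s0 _]; first exact: dth.
    by rewrite /r ler_pdivlMr ?N0//; exact: kN.
  apply/cvgryPge => M; near=> t.
  apply: le_trans (thk t _); last by near: t; exact: nbhs_pinfty_ge.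
  by rewrite -lerBlDl -ler_pdivrMl.
Unshelve. all: by end_near. Qed.

End PolarAngle.

(** * A criterion for a focus on an invariant surface *)

Section FocusCriterion.
Variable R : realType.
Implicit Types (F : 'rV[R]_3 -> 'rV[R]_3) (W : set 'rV[R]_3).
Implicit Types (p q u v w : 'rV[R]_3) (gamma : R -> 'rV[R]_3).

Lemma dotE u v : dot u v = u 0 0 * v 0 0 + u 0 1 * v 0 1 + u 0 2%:R * v 0 2%:R.
Proof.
rewrite /dot mxE !big_ord_recl big_ord0 !mxE addr0 addrA.
by do 3 ?[congr (_ + _)]; congr (_ * _); congr (fun_of_matrix _ _ _); apply/val_inj.
Qed.

Lemma dot_continuous u : continuous (fun q => dot q u).
Proof.
move=> q.
have c i : (fun x : 'rV[R]_3 => x 0 i * u 0 i) x @[x --> q] --> q 0 i * u 0 i.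
  exact: cvgM (@coord_continuous R 1 3 0 i q) (cvg_cst (u 0 i)).
have -> : (fun x => dot x u) = (fun x => x 0 0 * u 0 0 + x 0 1 * u 0 1 + x 0 2%:R * u 0 2%:R).
  by apply/funext => x; rewrite dotE.
exact: cvgD (cvgD (c _) (c _)) (c _).
Qed.

Lemma dot_derive gamma p u v (t : R) : is_derive t 1 gamma v ->
  is_derive t 1 (fun s => dot (gamma s - p) u) (dot v u).
Proof.
move=> /derive_vecP dg.
have d i : is_derive t 1 (fun s => (gamma s - p) 0 i * u 0 i) (v 0 i * u 0 i).
  have -> : (fun s => (gamma s - p) 0 i * u 0 i) =
      (fun s => u 0 i * (gamma s 0 i - p 0 i)).
    by apply/funext => s; rewrite !mxE mulrC.
  rewrite [X in is_derive _ _ _ X]mulrC -[v 0 i]subr0.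
  apply/derive_scale; exact: derive_sub (dg i) (is_derive_cst _ _ _).
have -> : (fun s => dot (gamma s - p) u) = (fun s => (gamma s - p) 0 0 * u 0 0 +
    (gamma s - p) 0 1 * u 0 1 + (gamma s - p) 0 2%:R * u 0 2%:R).
  by apply/funext => s; rewrite dotE.
rewrite dotE; exact: derive_add (derive_add (d _) (d _)) (d _).
Qed.

Lemma dot_le u v : `|dot u v| <= 3 * (`|u| * `|v|).
Proof.
have h i : `|u 0 i * v 0 i| <= `|u| * `|v|.
  by rewrite normrM ler_pM// coord_le_norm.
rewrite dotE; have := h 0; have := h 1; have := h 2%:R => h2 h1 h0.
have := ler_normD (u 0 0 * v 0 0 + u 0 1 * v 0 1) (u 0 2%:R * v 0 2%:R).
have := ler_normD (u 0 0 * v 0 0) (u 0 1 * v 0 1).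
lra.
Qed.

(** Orbits starting in a small sublevel set of [V] on [W] never leave it. There
[V] is squeezed between multiples of the squared distance to [p] and its
derivative is of the order of [- V ^+ 2], so [V] decreases to [0] without
reaching it, while the angle around [p] grows at least linearly. *)
Lemma attracting_focus_criterion F p W u v (V dV : 'rV[R]_3 -> R)
    (rho c1 c2 k M kappa L : R) :
  0 < rho -> 0 < c1 -> 0 < c2 -> 0 < k -> 0 < M -> 0 < kappa -> 0 <= L ->
  tangent_space W p u -> tangent_space W p v -> row_free (col_mx u v) ->
  locally_invariant F W ->
  closed (W `&` [set q | `|q - p| <= rho]) ->
  continuous F ->
  (forall q q', `|q - p| <= rho -> `|q' - p| <= rho ->
     `|F q - F q'| <= L * `|q - q'|) ->
  continuous V ->
  (forall gamma (t : R), is_derive t 1 gamma (F (gamma t)) ->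
     is_derive t 1 (V \o gamma) (dV (gamma t))) ->
  (forall q, W q -> `|q - p| <= rho ->
     [/\ c1 * `|q - p| ^+ 2 <= V q, V q <= c2 * `|q - p| ^+ 2,
         - (M * `|q - p| ^+ 4) <= dV q, dV q <= - (k * `|q - p| ^+ 4) &
         kappa * `|q - p| ^+ 2 <=
           dot (q - p) u * dot (F q) v - dot (q - p) v * dot (F q) u]) ->
  attracting_focus F p W.
Proof.
move=> rho0 c10 c20 k0 M0 kap0 L0 Tu Tv fuv inv cW cF FL cV dV_ est.
exists u, v; split => //.
pose h := c1 * rho ^+ 2 / 4.
have h0 : 0 < h by rewrite /h !mulr_gt0// exprn_gt0.
pose K := (W `&` [set q | `|q - p| <= rho]) `&` [set q | V q <= h].
have closedK : closed K.
  apply: closedI => //.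
  exact: (continuous_closedP V).1 cV _ (@closed_le _ h).
have K2 q : K q -> `|q - p| <= rho / 2.
  move=> [[Wq qr] /= Vq]; have [l _ _ _ _] := est q Wq qr.
  rewrite -(@ler_pXn2r _ 2)// ?nnegrE//; last by rewrite divr_ge0// ltW.
  rewrite -(ler_pM2l c10); apply: le_trans l _; apply: le_trans Vq _.
  by rewrite (_ : h = c1 * (rho / 2) ^+ 2)// /h; field.
have KF q : K q -> `|F q| <= `|F p| + L * rho.
  move=> [[Wq /= qr] _]; rewrite -[F q](subrK (F p)) addrC.
  apply: le_trans (ler_normD _ _) _; rewrite lerD2l.
  apply: le_trans (FL q p qr _) _; first by rewrite subrr normr0 ltW.
  by rewrite ler_wpM2l.
have KL q q' : K q -> K q' -> `|F q - F q'| <= L * `|q - q'|.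
  by move=> [[_ h1] _] [[_ h2] _]; exact: FL.
have dVle0 q : W q -> `|q - p| <= rho -> dV q <= 0.
  move=> Wq qr; have [_ _ _ l _] := est q Wq qr; apply: le_trans l _.
  by rewrite oppr_le0 mulr_ge0// ?exprn_ge0// ltW.
have locK q : K q -> exists2 T : R, 0 < T & exists gamma, [/\ gamma 0 = q,
    forall t, 0 <= t < T -> is_derive t 1 gamma (F (gamma t)) &
    forall t, 0 <= t < T -> K (gamma t)].
  move=> Kq; have [T T0 [gamma [g0 sg Wg]]] := inv q (Kq.1.1).
  have TI t : `|t| < T -> t \in `]- T, T[.
    by rewrite in_itv/= ltr_norml.
  have d0 : is_derive (0 : R) 1 gamma (F (gamma 0)).
    by apply: sg; apply: TI; rewrite normr0.
  have /cvgrPdist_le/(_ (rho / 2)) := is_derive_cvg d0.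
  rewrite divr_gt0// g0 => /(_ isT) [d /= dgt0 gd].
  have nearp t : `|t| < d -> `|gamma t - p| <= rho.
    move=> td; rewrite -[gamma t](subrK q) -addrA.
    apply: le_trans (ler_normD _ _) _; rewrite [leRHS](splitr rho).
    apply: lerD; last exact: K2.
    by rewrite distrC; apply: gd; rewrite /ball_/= sub0r normrN.
  exists (Num.min T d); first by rewrite lt_min T0.
  exists gamma; split => // t /andP[t0]; rewrite lt_min => /andP[tT td].
    by apply: sg; apply: TI; rewrite ger0_norm.
  have Wt s : 0 <= s <= t -> W (gamma s) /\ `|gamma s - p| <= rho.
    move=> /andP[s0 st]; split.
      by apply: Wg; apply: TI; rewrite ger0_norm// (le_lt_trans st).
    by apply: nearp; rewrite ger0_norm// (le_lt_trans st).
  have [W1 W2] : W (gamma t) /\ `|gamma t - p| <= rho by apply: Wt; rewrite t0/=.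
  split => //=.
  have := @derive_le_bound _ (V \o gamma) (dV \o gamma) 0 0 t t0.
  rewrite mul0r subr_le0 /= g0 => Vt.
  apply: le_trans (Vt _ _) Kq.2 => s st; last by have [? ?] := Wt s st; exact: dVle0.
  apply: dV_; apply: sg; apply: TI; move/andP: st => [s0 st].
  by rewrite ger0_norm// (le_lt_trans st).
pose del := Num.min (Num.min 1 rho) (h / c2).
have del0 : 0 < del by rewrite !lt_min ltr01 rho0 divr_gt0.
apply: (near_norm del0) => q; rewrite !lt_min => /andP[/andP[q1 qr] qh] Wq qp.
have Kq : K q.
  split; first by split => //=; exact: ltW.
  have [_ l _ _ _] := est q Wq (ltW qr); apply: le_trans l _.
  rewrite mulrC -ler_pdivlMr//; apply: le_trans (ltW qh).
  by rewrite expr2 ler_piMl// ltW.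
have [gamma [g0 sg Kg]] := global_solution L0 closedK KF KL cF locK Kq.
exists gamma; split; [exact: g0|exact: sg|by move=> t /Kg [[]]|].
have dg (t : R) : 0 <= t -> is_derive t 1 gamma (F (gamma t)).
  by move=> t0; apply: sg; rewrite in_itv/= t0.
pose f := V \o gamma.
have df (t : R) : 0 <= t -> is_derive t 1 f (dV (gamma t)).
  by move=> /dg; exact: dV_.
have eg (t : R) (t0 : 0 <= t) := est _ (Kg t t0).1.1 (Kg t t0).1.2.
have qp0 : 0 < `|q - p| by rewrite normr_gt0 subr_eq0; apply/eqP.
have f0 : 0 < f 0.
  rewrite /f /= g0; have [l _ _ _ _] := est q Wq (ltW qr).
  by apply: lt_le_trans l; rewrite mulr_gt0// exprn_gt0.
have fpos (t : R) : 0 <= t -> 0 < f t.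
  move=> t0; rewrite -oppr_lt0.
  have dNf s : 0 <= s <= t -> is_derive s 1 (fun x => - f x) (- dV (gamma s)).
    by move=> /andP[/df ? _]; exact: is_deriveN.
  have := gronwall (M := - (M * rho ^+ 2 / c1)) t0 dNf.
  move=> gr; apply: le_lt_trans (gr _) _.
    move=> s /andP[s0 _]; have [l1 _ l3 _ _] := eg s s0.
    rewrite mulrNN lerNl; apply: le_trans l3; rewrite lerN2.
    apply: (@le_trans _ _ (M * (rho ^+ 2 * `|gamma s - p| ^+ 2))).
      rewrite ler_pM2l// (_ : 4 = 2 + 2)%N// exprD ler_wpM2r ?exprn_ge0//.
      by apply: lerXn2r; rewrite ?nnegrE ?(ltW rho0)//; have [[_ /=]] := Kg s s0.
    rewrite (_ : _ * f s = M * (rho ^+ 2 * (c1^-1 * f s))); last by ring.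
    by rewrite ler_pM2l// ler_pM2l ?exprn_gt0// ler_pdivlMl.
  by rewrite mulNr oppr_lt0 mulr_gt0// expR_gt0.
have gp0 (t : R) : 0 <= t -> 0 < `|gamma t - p|.
  move=> t0; have [_ l2 _ _ _] := eg t t0.
  rewrite lt_neqAle normr_ge0 andbT eq_sym; apply/eqP => E.
  have := lt_le_trans (fpos t t0) l2.
  by rewrite E expr0n mulr0 ltxx.
split.
  apply/cvgrPdist_le => e e0.
  have [t0 [t00 ft0]] : exists t0, 0 <= t0 /\ f t0 <= c1 * e ^+ 2.
    apply: contrapT => hn.
    have hf (t : R) : 0 <= t -> c1 * e ^+ 2 <= f t.
      by move=> t0; rewrite leNgt; apply/negP => ft; apply: hn; exists t; split=> //; exact: ltW.
    pose m := k * (c1 * e ^+ 2 / c2) ^+ 2.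
    have m0 : 0 < m by rewrite mulr_gt0// exprn_gt0// divr_gt0// mulr_gt0// exprn_gt0.
    have t1 : 0 <= f 0 / m by rewrite divr_ge0// ltW.
    have : f (f 0 / m) - f 0 <= - m * (f 0 / m - 0).
      apply: (@derive_le_bound _ f (dV \o gamma)) => // s /andP[s0 _]; first exact: df.
      have [_ l2 _ l4 _] := eg s s0; apply: le_trans l4 _; rewrite lerN2 ler_pM2l//.
      rewrite (_ : 4 = 2 * 2)%N// exprM lerXn2r ?nnegrE ?exprn_ge0//.
        by rewrite divr_ge0// ?mulr_ge0// ?exprn_ge0// ltW.
      by rewrite ler_pdivrMr// [leRHS]mulrC; apply: le_trans l2; exact: hf.
    rewrite subr0 mulNr [m * _]mulrC divfK ?gt_eqF// => hle.
    by have := fpos _ t1; lra.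
  near=> t; have tt0 : t0 <= t by near: t; apply: nbhs_pinfty_ge; exact: num_real.
  have t0' : 0 <= t by exact: le_trans tt0.
  have [l1 _ _ _ _] := eg t t0'.
  have ft : f t <= f t0.
    rewrite -subr_le0 -(mul0r (t - t0)).
    apply: (@derive_le_bound _ f (dV \o gamma)) => // s /andP[s0 _].
      by apply: df; exact: le_trans s0.
    have s0' : 0 <= s by exact: le_trans s0.
    by have [[? ?] _] := Kg s s0'; exact: dVle0.
  rewrite distrC -(@ler_pXn2r _ 2)// ?nnegrE//; last exact: ltW.
  by rewrite -(ler_pM2l c10); apply: le_trans l1 (le_trans ft ft0).
pose C := 9 * (`|u| ^+ 2 + `|v| ^+ 2) + 1.
have C0 : 0 < C by rewrite ltr_wpDl// mulr_ge0// addr_ge0 ?exprn_ge0.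
have XC w : dot w u ^+ 2 + dot w v ^+ 2 <= C * `|w| ^+ 2.
  have sq x : dot w x ^+ 2 <= 9 * `|x| ^+ 2 * `|w| ^+ 2.
    rewrite -[leLHS]real_normK ?num_real//.
    apply: (@le_trans _ _ ((3 * (`|w| * `|x|)) ^+ 2)).
      by rewrite lerXn2r ?nnegrE ?mulr_ge0// dot_le.
    by rewrite !exprMn; lra.
  have := sq u; have := sq v; have : 0 <= `|w| ^+ 2 by rewrite exprn_ge0.
  by rewrite /C; lra.
pose X t := dot (gamma t - p) u; pose Y t := dot (gamma t - p) v.
have cont w (t : R) : 0 <= t -> {for t, continuous (fun s => dot (F (gamma s)) w)}.
  move=> /dg/is_derive_cvg cg.
  have cFg : {for t, continuous (F \o gamma)} := continuous_comp cg (cF (gamma t)).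
  exact: (continuous_comp cFg (@dot_continuous w (F (gamma t)))).
have [|||||||rho' [theta [h1 h2 h3]]] := @polar_lift _ X Y (fun t => dot (F (gamma t)) u)
    (fun t => dot (F (gamma t)) v) (kappa / C).
- by rewrite divr_gt0.
- by move=> t /dg d; exact: dot_derive.
- by move=> t /dg d; exact: dot_derive.
- by move=> t; exact: cont.
- by move=> t; exact: cont.
- move=> t t0; rewrite lt_neqAle addr_ge0 ?sqr_ge0// andbT eq_sym.
  rewrite paddr_eq0 ?sqr_ge0// !sqrf_eq0; apply/negP => /andP[/eqP X0 /eqP Y0].
  have [_ _ _ _] := eg t t0; rewrite -/(X t) -/(Y t) X0 Y0 !mul0r subr0.
  by rewrite leNgt mulr_gt0// exprn_gt0// gp0.
- move=> t t0; have [_ _ _ _] := eg t t0; apply: le_trans.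
  rewrite mulrAC ler_pdivrMr// -mulrA ler_pM2l// mulrC; exact: XC.
by exists rho', theta; split => //; left.
Unshelve. all: by end_near. Qed.

End FocusCriterion.

(** * Invariant surfaces near a point *)

Section InvariantSurface.
Variable R : realType.
Implicit Types (F : 'rV[R]_3 -> 'rV[R]_3) (W : set 'rV[R]_3).
Implicit Types (p q u v n e : 'rV[R]_3) (gamma : R -> 'rV[R]_3).

(** An embedded surface is locally closed: near [p] it is a zero set of a
continuous function. *)
Lemma surface_closed_near (r : nat) W p : (0 < r)%N -> surface_C r W -> W p ->
  exists2 rho0 : R, 0 < rho0 & forall rho, rho <= rho0 ->
    closed (W `&` [set q | `|q - p| <= rho]).
Proof.
case: r => // r _ sW Wp; have [U [g [oU Up [dg _] gW _]]] := sW p Wp.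
have /nbhs_ballP[d d0 dU] : nbhs p U by exact: open_nbhs_nbhs.
exists (d / 2); first by rewrite /= divr_gt0.
move=> rho hrho.
have cB : closed [set q | `|q - p| <= rho].
  have := @closed_closed_ball_ R 'rV[R]_3 p rho.
  by congr (closed _); apply/funext => q; rewrite /closed_ball_/= distrC.
move=> q cq.
have qr : `|q - p| <= rho by apply: cB; apply: closureS cq => x [].
split => //.
have Uq : U q.
  apply: dU; rewrite -ball_normE /ball_/= distrC; apply: le_lt_trans qr _.
  by apply: le_lt_trans hrho _; rewrite ltr_pdivrMr// ltr_pMr// ltr1n.
apply/(gW q Uq); apply: contrapT => /eqP gq.
have cg : {for q, continuous g} by exact/differentiable_continuous/dg.
have nz : \forall x \near q, g x != 0 by exact: (cvgr_neq0 (g q) cg gq).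
have nU : \forall x \near q, U x by exact: open_nbhs_nbhs.
have [x [[Wx _] [gx Ux]]] := cq _ (filterI nz nU).
by move: gx; rewrite ((gW x Ux).1 Wx) eqxx.
Qed.

(** The chain rule along a curve drawn on the surface. *)
Lemma tangent_diff0 W p v (g : 'rV[R]_3 -> R) :
  differentiable g p -> (\forall q \near p, W q -> g q = 0) ->
  tangent_space W p v -> 'd g p v = 0.
Proof.
move=> dg gW [gamma [g0 Wg dgam]].
have dgamma : differentiable gamma 0 by have [/derivable1_diffP] := dgam.
have dg' : differentiable g (gamma 0) by rewrite g0.
have near0 : \forall t \near (0 : R), g (gamma t) = 0.
  have cg : gamma t @[t --> (0 : R)] --> p by rewrite -g0; exact: is_derive_cvg dgam.
  have h : \forall t \near (0 : R), W (gamma t) -> g (gamma t) = 0 := cg _ gW.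
  by near=> t; (have : W (gamma t) by near: t); near: t.
have E : 'd (g \o gamma) 0 1 = 0.
  rewrite -deriveE; last exact: differentiable_comp.
  rewrite (@near_eq_derive _ _ _ (g \o gamma) (cst 0))//.
  by rewrite derive_cst.
have dv : 'd gamma 0 1 = v by rewrite -deriveE//; have [_] := dgam.
by move: E; rewrite diff_comp//= dv g0.
Unshelve. all: by end_near. Qed.

(** The surface is the zero set of a function whose differential at [p] is a
nonzero multiple of the linear form that cuts out the tangent plane, so the
value of this form on [q - p] is the first-order remainder of that function. *)
Lemma surface_tangent_cone (r : nat) W p n e (eps : R) :
  (0 < r)%N -> surface_C r W -> W p -> 
  tangent_space W p = [set v | dot v n = 0] -> dot e n = 1 -> 0 < eps ->
  \forall q \near p, W q -> `|dot (q - p) n| <= eps * `|q - p|.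
Proof.
case: r => // r _ sW Wp TW en eps0.
have [U [g [oU Up [dg _] gW gv]]] := sW p Wp.
have gdp := dg p Up.
have nU : \forall q \near p, U q by exact: open_nbhs_nbhs.
have dT v : dot v n = 0 -> 'd g p v = 0.
  move=> vn; apply: (@tangent_diff0 W) => //.
    by apply: filterS nU => q Uq /(gW q Uq).
  by rewrite TW.
have dE h : 'd g p h = dot h n * 'd g p e.
  have : 'd g p (h - dot h n *: e) = 0.
    apply: dT; move: en; rewrite !dotE !mxE => en.
    set c := h 0 0 * n 0 0 + _ + _.
    transitivity (c * (1 - (e 0 0 * n 0 0 + e 0 1 * n 0 1 + e 0 2%:R * n 0 2%:R))).
      by rewrite /c; ring.
    by rewrite en subrr mulr0.
  by rewrite linearB linearZ/= => /eqP; rewrite subr_eq0 => /eqP.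
have de0 : 'd g p e != 0.
  have [v] := gv p Up Wp; rewrite deriveE// (dE v) => hv; apply/eqP => E0.
  by move: hv; rewrite E0 mulr0 eqxx.
have := diff_locally gdp => /eqaddoP /(_ (eps * `|'d g p e|)).
rewrite mulr_gt0 ?normr_gt0// => /(_ isT) /nbhs_ballP[d /= d0 hd].
have nd : \forall q \near p, `|q - p| < d by exact: (near_norm d0).
near=> q => Wq.
have Uq : U q by near: q.
have qd : `|q - p| < d by near: q.
have /= := hd (q - p); rewrite -ball_normE /ball_/= sub0r normrN => /(_ qd).
rewrite /shift /= !fctE /= subrK ((gW q Uq).1 Wq) ((gW p Up).1 Wp).
by rewrite sub0r add0r normrN dE normrM mulrAC ler_pM2r ?normr_gt0.
Unshelve. all: by end_near. Qed.

Lemma locally_invariant_opp F W : locally_invariant F W ->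
  locally_invariant (fun q => - F q) W.
Proof.
move=> inv q Wq; have [T T0 [gamma [g0 sg Wg]]] := inv q Wq.
have I (t : R) : t \in `]- T, T[ -> - t \in `]- T, T[.
  by rewrite !in_itv/= => /andP[? ?]; apply/andP; split; lra.
exists T => //; exists (fun t => gamma (- t)); split.
- by rewrite oppr0.
- move=> t /I/sg /derive_vecP dg; apply/derive_vecP => i; rewrite !mxE.
  have dN : is_derive t 1 (fun s : R => - s) (-1).
    exact: is_deriveN.
  have := @is_derive1_comp _ (fun s => gamma s 0 i) (fun s : R => - s) t _ _ (dg i) dN.
  by rewrite mulrN1.
- by move=> t /I/Wg.
Qed.

End InvariantSurface.

(** * The Lyapunov function *)

Section NormalForm.
Variable R : realType.
Implicit Types (f g : R -> R -> R -> R).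

(** The growth of a form of degree [j] in [(D, Z, w)], together with the fact that
setting [w = 0] changes it by a multiple of [w]. With the factor [n] on its left
the second estimate is stable under products, also by forms of degree zero. *)
Definition of_order (j : nat) f := exists2 C : R, 0 <= C &
  forall D Z w n, `|D| <= n -> `|Z| <= n -> `|w| <= n ->
    `|f D Z w| <= C * n ^+ j /\
    `|f D Z w - f D Z 0| * n <= C * `|w| * n ^+ j.

Lemma of_order_cst a : of_order 0 (fun _ _ _ => a).
Proof.
exists `|a| => // D Z w n hD hZ hw; rewrite expr0 mulr1 subrr normr0 mul0r; split => //.
Qed.

Lemma of_order_D : of_order 1 (fun D _ _ => D).
Proof.
exists 1 => // D Z w n hD hZ hw; rewrite expr1 mul1r subrr normr0 mul0r; split => //.
by rewrite !mulr_ge0// (le_trans _ hD).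
Qed.

Lemma of_order_Z : of_order 1 (fun _ Z _ => Z).
Proof.
exists 1 => // D Z w n hD hZ hw; rewrite expr1 mul1r subrr normr0 mul0r; split => //.
by rewrite !mulr_ge0// (le_trans _ hD).
Qed.

Lemma of_order_w : of_order 1 (fun _ _ w => w).
Proof.
by exists 1 => // D Z w n hD hZ hw; rewrite expr1 !mul1r subr0.
Qed.

Lemma of_orderD j f g : of_order j f -> of_order j g ->
  of_order j (fun D Z w => f D Z w + g D Z w).
Proof.
move=> [C1 C10 h1] [C2 C20 h2]; exists (C1 + C2); first exact: addr_ge0.
move=> D Z w n hD hZ hw.
have [a1 b1] := h1 D Z w n hD hZ hw; have [a2 b2] := h2 D Z w n hD hZ hw.
have n0 : 0 <= n by rewrite (le_trans _ hD).
split; first by rewrite mulrDl; apply: le_trans (ler_normD _ _) (lerD a1 a2).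
rewrite !mulrDl opprD addrACA; apply: le_trans (lerD b1 b2).
by rewrite -mulrDl ler_wpM2r// ler_normD.
Qed.

Lemma of_orderM j1 j2 j f g : of_order j1 f -> of_order j2 g -> j = (j1 + j2)%N ->
  of_order j (fun D Z w => f D Z w * g D Z w).
Proof.
move=> [C1 C10 h1] [C2 C20 h2] ->; exists (C1 * C2 *+ 2); first by rewrite mulrn_wge0// mulr_ge0.
move=> D Z w n hD hZ hw.
have n0 : 0 <= n by rewrite (le_trans _ hD).
have [a1 b1] := h1 D Z w n hD hZ hw; have [a2 b2] := h2 D Z w n hD hZ hw.
have z0 : `|0 : R| <= n by rewrite normr0.
have [a3 _] := h2 D Z 0 n hD hZ z0.
have nj i : 0 <= n ^+ i by rewrite exprn_ge0.
have CC : 0 <= C1 * C2 by exact: mulr_ge0.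
split.
  rewrite normrM; apply: le_trans (ler_pM _ _ a1 a2) _ => //.
  rewrite mulrACA -exprD ler_wpM2r// mulr2n; lra.
have -> : f D Z w * g D Z w - f D Z 0 * g D Z 0 =
  f D Z w * (g D Z w - g D Z 0) + (f D Z w - f D Z 0) * g D Z 0 by ring.
apply: le_trans (_ : (`|f D Z w| * `|g D Z w - g D Z 0| +
                      `|f D Z w - f D Z 0| * `|g D Z 0|) * n <= _).
  by rewrite ler_wpM2r// -!normrM ler_normD.
have e1 : `|f D Z w| * (`|g D Z w - g D Z 0| * n) <=
    (C1 * n ^+ j1) * (C2 * `|w| * n ^+ j2) by apply: ler_pM => //; rewrite mulr_ge0.
have e2 : (`|f D Z w - f D Z 0| * n) * `|g D Z 0| <=
    (C1 * `|w| * n ^+ j1) * (C2 * n ^+ j2) by apply: ler_pM => //; rewrite mulr_ge0.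
apply: le_trans (_ : (C1 * n ^+ j1) * (C2 * `|w| * n ^+ j2) +
   (C1 * `|w| * n ^+ j1) * (C2 * n ^+ j2) <= _); last first.
  by rewrite le_eqVlt; apply/orP; left; apply/eqP; rewrite exprD; ring.
by rewrite mulrDl -[X in X + _ <= _]mulrA mulrAC; exact: lerD.
Qed.

Lemma of_orderN j f : of_order j f -> of_order j (fun D Z w => - f D Z w).
Proof.
move=> [C C0 h]; exists C => // D Z w n hD hZ hw.
by rewrite -opprD !normrN; exact: h.
Qed.

Lemma of_orderX i j j' f : of_order j f -> j' = (i * j)%N ->
  of_order j' (fun D Z w => f D Z w ^+ i).
Proof.
move=> hf ->; elim: i => [|i ih]; first exact: of_order_cst.
have -> : (fun D Z w => f D Z w ^+ i.+1) = (fun D Z w => f D Z w * f D Z w ^+ i).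
  by apply/funext => D; apply/funext => Z; apply/funext => w; rewrite exprS.
exact: of_orderM hf ih _.
Qed.

(** A form of degree [j + 1] is dominated by [n ^+ j] near the origin. *)
Lemma of_order_small j f (d : R) : of_order j.+1 f -> 0 < d ->
  exists2 r, 0 < r & forall D Z w n,
    `|D| <= n -> `|Z| <= n -> `|w| <= n -> n <= r -> `|f D Z w| <= d * n ^+ j.
Proof.
move=> [C C0 h] d0; have C1 : 0 < C + 1 by lra.
exists (d / (C + 1)); first by rewrite divr_gt0.
move=> D Z w n hD hZ hw nr; have [a _] := h D Z w n hD hZ hw.
have n0 : 0 <= n by rewrite (le_trans _ hD).
apply: le_trans a _; rewrite exprS mulrA ler_wpM2r ?exprn_ge0//.
apply: le_trans (_ : (C + 1) * n <= _); first by rewrite ler_wpM2r//; lra.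
by rewrite mulrC -ler_pdivlMr.
Qed.

(** In a thin cone around the plane [w = 0] the value of a form is close to its
value on this plane. *)
Lemma of_order_cone j f (d : R) : of_order j f -> 0 < d ->
  exists2 r, 0 < r & forall D Z w n,
    `|D| <= n -> `|Z| <= n -> `|w| <= r * n ->
    `|f D Z w - f D Z 0| <= d * n ^+ j.
Proof.
move=> [C C0 h] d0; have C1 : 0 < C + 1 by lra.
exists (Num.min 1 (d / (C + 1))); first by rewrite lt_min ltr01 divr_gt0.
move=> D Z w n hD hZ hw.
have n0 : 0 <= n by rewrite (le_trans _ hD).
have wn : `|w| <= n.
  by apply: le_trans hw _; rewrite ler_piMl// ge_min lexx.
have [_ b] := h D Z w n hD hZ wn.
have [n00|np] := leP n 0.
  have w0 : w = 0 by apply/eqP; rewrite -normr_le0 (le_trans wn).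
  by rewrite w0 subrr normr0 mulr_ge0// ?exprn_ge0// ltW.
have dn : C * `|w| <= d * n.
  apply: le_trans (_ : (C + 1) * `|w| <= _); first by rewrite ler_wpM2r//; lra.
  rewrite mulrC -ler_pdivlMr// mulrAC; apply: le_trans hw _.
  by rewrite ler_wpM2r// ge_min lexx orbT.
rewrite -(ler_pM2r np); apply: le_trans b _.
by rewrite [leRHS]mulrAC ler_wpM2r// exprn_ge0.
Qed.

End NormalForm.
(** The degree of a product is found from those of its factors, so it is left to
unification. *)
Ltac of_order := lazymatch goal with
  | |- of_order _ (fun D Z w => D) => exact: of_order_D
  | |- of_order _ (fun D Z w => Z) => exact: of_order_Z
  | |- of_order _ (fun D Z w => w) => exact: of_order_w
  | |- of_order _ (fun D Z w => _ + _) => eapply of_orderD; of_order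
  | |- of_order _ (fun D Z w => - _) => eapply of_orderN; of_order
  | |- of_order _ (fun D Z w => _ * _) =>
      eapply of_orderM; [of_order|of_order|reflexivity]
  | |- of_order _ (fun D Z w => _ ^+ _) => eapply of_orderX; [of_order|reflexivity]
  | |- _ => exact: of_order_cst
  end.

Section LyapunovFunction.
Variable R : realType.
Variables (c al o : R).

(** In the coordinates [(D, Z, S)] the field is
[D' = - o Z + (o D - s S) Z / 2], [Z' = D + (S ^ 2 - D ^ 2) / 4],
[S' = 2 c S - s Z + (s D - o S) Z / 2] with [s = coupling], and
[w = S + al (D + 2 c Z)] is the linear form with [w' = 2 c w + ...]. The
functions [quadD], [quadZ], [quadw] are the quadratic parts of [D'], [Z'] and
[w'] in terms of [(D, Z, w)]. *)
Definition coupling := - al * (o + 4 * c ^+ 2).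
Definition sum_coord D Z w : R := w - al * (D + 2 * c * Z).
Definition quadD D Z w : R := (o * D - coupling * sum_coord D Z w) * Z / 2.
Definition quadZ D Z w : R := (sum_coord D Z w ^+ 2 - D ^+ 2) / 4.
Definition quadw D Z w : R :=
  (coupling * D - o * sum_coord D Z w) * Z / 2 + al * quadD D Z w +
  2 * c * al * quadZ D Z w.

(** The coefficients of [cubic] solve the linear system that expresses
[cubic_homological]; [coef_w] and [coef_w2] come from the terms of degree one
and two in [w]. *)
Definition coef_w : R := al * (o + 2 * c ^+ 2) / (2 * (o + c ^+ 2)).
Definition coef_w2 : R := o / (2 * (o + 16 * c ^+ 2)).

Definition cubic D Z w : R :=
  (1 - al ^+ 2) / 6 * D ^+ 3 + 2 * c ^+ 2 * al ^+ 2 * D * Z ^+ 2 +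
  8 * c ^+ 3 * al ^+ 2 / 3 * Z ^+ 3 +
  w * (coef_w * D ^+ 2 - 2 * c * coef_w * D * Z + o * (al - coef_w) * Z ^+ 2) +
  w ^+ 2 * (coef_w2 * D - 4 * c * coef_w2 * Z).
(* [cubicD], [cubicZ] and [cubicw] are the partial derivatives of [cubic]. *)
Definition cubicD D Z w : R :=
  (1 - al ^+ 2) / 2 * D ^+ 2 + 2 * c ^+ 2 * al ^+ 2 * Z ^+ 2 +
  w * (2 * coef_w * D - 2 * c * coef_w * Z) + w ^+ 2 * coef_w2.
Definition cubicZ D Z w : R :=
  4 * c ^+ 2 * al ^+ 2 * D * Z + 8 * c ^+ 3 * al ^+ 2 * Z ^+ 2 +
  w * (- 2 * c * coef_w * D + 2 * o * (al - coef_w) * Z) - w ^+ 2 * (4 * c * coef_w2).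
Definition cubicw D Z w : R :=
  coef_w * D ^+ 2 - 2 * c * coef_w * D * Z + o * (al - coef_w) * Z ^+ 2 +
  2 * w * (coef_w2 * D - 4 * c * coef_w2 * Z).

(** All cubic terms of the derivative of [D ^+ 2 + o * Z ^+ 2] can be cancelled,
because no sum of three of the eigenvalues [i sqrt o], [- i sqrt o], [2 * c] of
the linear part vanishes. *)
Lemma cubic_homological D Z w : o + c ^+ 2 != 0 -> o + 16 * c ^+ 2 != 0 ->
  2 * D * quadD D Z w + 2 * o * Z * quadZ D Z w +
  (cubicD D Z w * (- o * Z) + cubicZ D Z w * D + cubicw D Z w * (2 * c * w)) = 0.
Proof.
move=> h1 h2.
rewrite /cubicD /cubicZ /cubicw /quadD /quadZ /sum_coord /coupling /coef_w /coef_w2.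
by field; rewrite h1 h2.
Qed.

(** Along the rotation [D' = - o Z], [Z' = D] every quartic form can be averaged:
up to a derivative it is a multiple of [(D ^+ 2 + o * Z ^+ 2) ^+ 2]. *)
Lemma quartic_homological (a40 a31 a22 a13 a04 l : R) : o != 0 ->
  8 * o * l = 3 * o * a40 + a22 + 3 * a04 / o ->
  exists k40 k31 k13 k04 : R, forall D Z : R,
    a40 * D ^+ 4 + a31 * D ^+ 3 * Z + a22 * D ^+ 2 * Z ^+ 2 + a13 * D * Z ^+ 3 +
      a04 * Z ^+ 4 +
    ((4 * k40 * D ^+ 3 + 3 * k31 * D ^+ 2 * Z + k13 * Z ^+ 3) * (- o * Z) +
     (k31 * D ^+ 3 + 3 * k13 * D * Z ^+ 2 + 4 * k04 * Z ^+ 3) * D) =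
    l * (D ^+ 2 + o * Z ^+ 2) ^+ 2.
Proof.
move=> o0 hl.
(* The coefficient of [D ^+ 2 * Z ^+ 2] is normalized to zero; it could be
   absorbed by a multiple of the first integral of the rotation. *)
exists (a31 / (4 * o)), (l - a40), ((a04 - o ^+ 2 * l) / o), (- a13 / 4) => D Z.
have -> : a22 = 8 * o * l - 3 * o * a40 - 3 * a04 / o by rewrite hl; ring.
by field.
Qed.

(** The first Lyapunov coefficient of the equilibrium: the average over the
rotation of [cubic_rate D Z 0], divided by [(D ^+ 2 + o * Z ^+ 2) ^+ 2]. *)
Definition lyapunov_coef : R := - c ^+ 3 * al ^+ 2 / (2 * (o + c ^+ 2)).

Definition cubic_rate D Z w := cubicD D Z w * quadD D Z w +
  cubicZ D Z w * quadZ D Z w + cubicw D Z w * quadw D Z w.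

(** The quartic terms that contain [w] are left alone: they need not be
cancelled on a surface tangent to the plane [w = 0]. *)
Lemma averaged_rate : o != 0 -> o + c ^+ 2 != 0 ->
  exists k40 k31 k13 k04 : R, forall D Z : R,
    cubic_rate D Z 0 +
    ((4 * k40 * D ^+ 3 + 3 * k31 * D ^+ 2 * Z + k13 * Z ^+ 3) * (- o * Z) +
     (k31 * D ^+ 3 + 3 * k13 * D * Z ^+ 2 + 4 * k04 * Z ^+ 3) * D) =
    lyapunov_coef * (D ^+ 2 + o * Z ^+ 2) ^+ 2.
Proof.
move=> o0 h1.
pose g2 : R := - 2 * c * coef_w; pose g3 := o * (al - coef_w).
(* The coefficients of [cubic_rate D Z 0]. *)
pose a40 := (- 1 / 2) * al * c * coef_w +
    (1 / 2) * al ^+ 3 * c * coef_w.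
pose a31 := (1 / 4) * o +
    (1 / 2) * al * o * coef_w +
    (- 1 / 2) * al * c * g2 +
    (- 2) * al * c ^+ 2 * coef_w +
    (- 1 / 2) * al ^+ 2 * o +
    (- 2) * al ^+ 2 * c ^+ 2 +
    (- 1 / 2) * al ^+ 3 * o * coef_w +
    (1 / 2) * al ^+ 3 * c * g2 +
    (1 / 4) * al ^+ 4 * o +
    2 * al ^+ 4 * c ^+ 2.
pose a22 := (1 / 2) * al * o * g2 +
    (- 1 / 2) * al * c * g3 +
    al * c * o * coef_w +
    (- 2) * al * c ^+ 2 * g2 +
    (- 1 / 2) * al ^+ 2 * c * o +
    (- 4) * al ^+ 2 * c ^+ 3 +
    (- 1 / 2) * al ^+ 3 * o * g2 +
    (1 / 2) * al ^+ 3 * c * g3 +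
    (- 1) * al ^+ 3 * c * o * coef_w +
    (- 2) * al ^+ 3 * c ^+ 3 * coef_w +
    (1 / 2) * al ^+ 4 * c * o +
    8 * al ^+ 4 * c ^+ 3.
pose a13 := (1 / 2) * al * o * g3 +
    al * c * o * g2 +
    (- 2) * al * c ^+ 2 * g3 +
    al ^+ 2 * c ^+ 2 * o +
    (- 1 / 2) * al ^+ 3 * o * g3 +
    (- 1) * al ^+ 3 * c * o * g2 +
    (- 2) * al ^+ 3 * c ^+ 3 * g2 +
    (- 1) * al ^+ 4 * c ^+ 2 * o +
    8 * al ^+ 4 * c ^+ 4.
pose a04 := al * c * o * g3 +
    (- 1) * al ^+ 3 * c * o * g3 +
    (- 2) * al ^+ 3 * c ^+ 3 * g3 +
    (- 2) * al ^+ 4 * c ^+ 3 * o.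
have [|k40 [k31 [k13 [k04 K]]]] :=
    @quartic_homological a40 a31 a22 a13 a04 lyapunov_coef o0.
  rewrite /lyapunov_coef /a40 /a22 /a04 /g3 /g2 /coef_w.
  by field; rewrite o0.
exists k40, k31, k13, k04 => D Z; rewrite -K; congr (_ + _).
rewrite /cubic_rate /cubicD /cubicZ /cubicw /quadw /quadD /quadZ /sum_coord.
rewrite /coupling /a40 /a31 /a22 /a13 /a04 /g3 /g2.
by field.
Qed.

Variables (k40 k31 k13 k04 : R).

(* [lyapD], [lyapZ] and [cubicw] are the partial derivatives of [lyap]. *)
Definition lyap D Z w : R := D ^+ 2 + o * Z ^+ 2 + cubic D Z w +
  (k40 * D ^+ 4 + k31 * D ^+ 3 * Z + k13 * D * Z ^+ 3 + k04 * Z ^+ 4).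
Definition quarticD D Z : R := 4 * k40 * D ^+ 3 + 3 * k31 * D ^+ 2 * Z + k13 * Z ^+ 3.
Definition quarticZ D Z : R := k31 * D ^+ 3 + 3 * k13 * D * Z ^+ 2 + 4 * k04 * Z ^+ 3.
Definition lyapD D Z w : R := 2 * D + cubicD D Z w + quarticD D Z.
Definition lyapZ D Z w : R := 2 * o * Z + cubicZ D Z w + quarticZ D Z.

Definition speedD D Z w : R := - o * Z + quadD D Z w.
Definition speedZ D Z w : R := D + quadZ D Z w.
Definition speedw D Z w : R := 2 * c * w + quadw D Z w.

Definition lyap_rate D Z w : R := lyapD D Z w * speedD D Z w +
  lyapZ D Z w * speedZ D Z w + cubicw D Z w * speedw D Z w.

(** The numerator of the angular velocity of the point with the coordinates
[D - kD * w] and [Z - kw * w]. *)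
Definition angular_rate kD kw D Z w : R :=
  (D - kD * w) * (speedZ D Z w - kw * speedw D Z w) -
  (Z - kw * w) * (speedD D Z w - kD * speedw D Z w).

Hypothesis averaged : forall D Z : R,
  cubic_rate D Z 0 + (quarticD D Z * (- o * Z) + quarticZ D Z * D) =
  lyapunov_coef * (D ^+ 2 + o * Z ^+ 2) ^+ 2.

(** In the derivative of [lyap] the cubic terms cancel and the quartic terms
average out, up to terms divisible by [w], which are small on a thin cone, and
terms of order five, which are small near the origin. *)
Lemma lyapunov_estimates (kD kw b d : R) : 0 < o -> c != 0 -> 0 < b -> 0 < d ->
  exists eps r : R, [/\ 0 < eps, 0 < r & forall D Z w n : R,
    `|D| <= n -> `|Z| <= n -> `|w| <= n -> `|w| <= eps * n -> n <= r -> 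
    b * n ^+ 2 <= D ^+ 2 + o * Z ^+ 2 ->
    [/\ b / 2 * n ^+ 2 <= lyap D Z w, lyap D Z w <= (3 + o) * n ^+ 2,
        `|lyap_rate D Z w - lyapunov_coef * (D ^+ 2 + o * Z ^+ 2) ^+ 2| <= d * n ^+ 4 &
        b / 2 * n ^+ 2 <= angular_rate kD kw D Z w]].
Proof.
move=> o0 c0 b0 d0.
have c2 : 0 < c ^+ 2 by rewrite exprn_even_gt0.
have h1 : o + c ^+ 2 != 0 by rewrite gt_eqF// addr_gt0.
have h2 : o + 16 * c ^+ 2 != 0 by rewrite gt_eqF// addr_gt0// mulr_gt0.
pose bb := Num.min 1 (b / 4).
have bb0 : 0 < bb by rewrite lt_min ltr01 divr_gt0.
have [bb1 bb4] : bb <= 1 /\ bb <= b / 4 by rewrite !ge_min !lexx orbT.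
pose quartic D Z (w : R) := k40 * D ^+ 4 + k31 * D ^+ 3 * Z + k13 * D * Z ^+ 3 + k04 * Z ^+ 4.
pose quintic D Z w := quarticD D Z * quadD D Z w + quarticZ D Z * quadZ D Z w.
pose A2 D Z w := (D - kD * w) * (D - kw * (2 * c * w)) -
                 (Z - kw * w) * (- o * Z - kD * (2 * c * w)).
pose A3 D Z w := (D - kD * w) * (quadZ D Z w - kw * quadw D Z w) -
                 (Z - kw * w) * (quadD D Z w - kD * quadw D Z w).
have o3 : of_order 3 cubic by rewrite /cubic; of_order.
have o4 : of_order 4 quartic by rewrite /quartic; of_order.
have q4 : of_order 4 cubic_rate.
  rewrite /cubic_rate /cubicD /cubicZ /cubicw /quadw /quadD /quadZ /sum_coord.
  by of_order.
have q5 : of_order 5 quintic.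
  by rewrite /quintic /quarticD /quarticZ /quadD /quadZ /sum_coord; of_order.
have a2 : of_order 2 A2 by rewrite /A2; of_order.
have a3 : of_order 3 A3.
  by rewrite /A3 /quadw /quadD /quadZ /sum_coord; of_order.
have d2 : 0 < d / 2 by lra.
have [r1 r10 R1] := of_order_small o3 bb0.
have [r2 r20 R2] := of_order_small o4 bb0.
have [r3 r30 R3] := of_order_cone q4 d2.
have [r4 r40 R4] := of_order_small q5 d2.
have [r5 r50 R5] := of_order_cone a2 bb0.
have [r6 r60 R6] := of_order_small a3 bb0.
exists (Num.min r3 r5), (Num.min (Num.min 1 r1) (Num.min r2 (Num.min r4 r6))).
split; [by rewrite lt_min r30|by rewrite !lt_min ltr01 r10 r20 r40|].
move=> D Z w n hD hZ hw hwe.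
rewrite !le_min => /andP[/andP[n1 nr1] /andP[nr2 /andP[nr4 nr6]]] hb.
have n0 : 0 <= n by rewrite (le_trans _ hD).
have hw3 : `|w| <= r3 * n by apply: le_trans hwe _; rewrite ler_wpM2r// ge_min lexx.
have hw5 : `|w| <= r5 * n by apply: le_trans hwe _; rewrite ler_wpM2r// ge_min lexx orbT.
have e1 := R1 _ _ _ _ hD hZ hw nr1.
have e2 := R2 _ _ _ _ hD hZ hw nr2.
have e3 := R3 _ _ _ _ hD hZ hw3.
have e4 := R4 _ _ _ _ hD hZ hw nr4.
have e5 := R5 _ _ _ _ hD hZ hw5.
have e6 := R6 _ _ _ _ hD hZ hw nr6.
have n2 : 0 <= n ^+ 2 by exact: exprn_ge0.
have n32 : n ^+ 3 <= n ^+ 2 by rewrite exprS ler_piMl.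
have Nle : D ^+ 2 + o * Z ^+ 2 <= (1 + o) * n ^+ 2.
  have sq x : `|x| <= n -> x ^+ 2 <= n ^+ 2.
    by move=> hx; rewrite -(real_normK (num_real x)) lerXn2r ?nnegrE.
  by rewrite mulrDl mul1r lerD ?sq// ler_wpM2l ?sq// ltW.
have e2' : `|quartic D Z w| <= bb * n ^+ 2.
  by apply: le_trans e2 _; rewrite ler_wpM2l// ltW.
have bbn4 : bb * n ^+ 2 <= b / 4 * n ^+ 2 by rewrite ler_wpM2r.
have bbn1 : bb * n ^+ 2 <= n ^+ 2 by rewrite ler_piMl.
have lyapE : lyap D Z w = D ^+ 2 + o * Z ^+ 2 + cubic D Z w + quartic D Z w by [].
move: e1 e2'; rewrite !ler_norml => /andP[e11 e12] /andP[e21 e22].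
split.
- by rewrite lyapE; lra.
- rewrite lyapE.
  by lra.
- have -> : lyap_rate D Z w - lyapunov_coef * (D ^+ 2 + o * Z ^+ 2) ^+ 2 =
    (cubic_rate D Z w - cubic_rate D Z 0) + quintic D Z w.
    rewrite -averaged /lyap_rate /lyapD /lyapZ /speedD /speedZ /speedw.
    have := cubic_homological D Z w h1 h2.
    rewrite /cubic_rate /quintic => E.
    set x := cubicD D Z w in E *; set y := cubicZ D Z w in E *; set z := cubicw D Z w in E *.
    rewrite -[RHS]addr0 -E; ring.
  rewrite -ler_norml; apply: le_trans (ler_normD _ _) _; lra.
- have A20 : A2 D Z 0 = D ^+ 2 + o * Z ^+ 2 by rewrite /A2; ring.
  have AE : angular_rate kD kw D Z w = A2 D Z w + A3 D Z w.
    by rewrite /angular_rate /A2 /A3 /speedD /speedZ /speedw; ring.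
  rewrite AE; move: e5 e6; rewrite A20 !ler_norml => /andP[e51 e52] /andP[e61 e62].
  lra.
Qed.

End LyapunovFunction.

(** * Hopf points and center planes *)

Section HopfFrame.
Variable R : realType.
Implicit Types (x y v h : 'rV[R]_3) (M : 'M[R]_3).

Lemma dotDl x y v : dot (x + y) v = dot x v + dot y v.
Proof. by rewrite !dotE !mxE; ring. Qed.

Lemma dotZl (a : R) x v : dot (a *: x) v = a * dot x v.
Proof. by rewrite !dotE !mxE; ring. Qed.

Lemma dotBr x y v : dot x (y - v) = dot x y - dot x v.
Proof. by rewrite !dotE !mxE; ring. Qed.

Lemma dotZr (a : R) x v : dot x (a *: v) = a * dot x v.
Proof. by rewrite !dotE !mxE; ring. Qed.

(** A dual family is a right inverse. *)
Lemma row_free_dual x y u v : dot x u = 1 -> dot y u = 0 -> dot x v = 0 ->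
  dot y v = 1 -> row_free (col_mx u v).
Proof.
move=> xu yu xv yv; apply/row_freeP; exists (row_mx x^T y^T).
have sw a b : (a *m b^T) = (dot b a)%:M :> 'M[R]_1.
  apply/matrixP => i j; rewrite (ord1 i) (ord1 j) !mxE eqxx mulr1n /dot mxE.
  by apply: eq_bigr => k _; rewrite !mxE mulrC.
rewrite mul_col_row !sw xu yu xv yv.
by rewrite -[LHS]/(block_mx _ _ _ _) (_ : 0%:M = 0) ?scalar_mx_block//; apply/matrixP => i j; rewrite !mxE mul0rn.
Qed.

(** Taking real and imaginary parts turns the complex eigenvector equation into a
rotation of the plane they span. *)
Lemma eigenspace_imaginary M (om : R) (w : 'rV[R[i]]_3) :
  (w <= eigenspace (map_mx (real_complex R) M) (Complex 0 om))%MS =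
  (map_mx (@complex.Re R) w *m M == - om *: map_mx (@complex.Im R) w) &&
  (map_mx (@complex.Im R) w *m M == om *: map_mx (@complex.Re R) w).
Proof.
have ReM : map_mx (@complex.Re R) (w *m map_mx (real_complex R) M) =
    map_mx (@complex.Re R) w *m M.
  apply/rowP => j; rewrite !mxE raddf_sum/=; apply: eq_bigr => k _; rewrite !mxE.
  by case: (w 0 k) => a b /=; rewrite mulr0 subr0.
have ImM : map_mx (@complex.Im R) (w *m map_mx (real_complex R) M) =
    map_mx (@complex.Im R) w *m M.
  apply/rowP => j; rewrite !mxE raddf_sum/=; apply: eq_bigr => k _; rewrite !mxE.
  by case: (w 0 k) => a b /=; rewrite mulr0 add0r.
have ReZ : map_mx (@complex.Re R) (Complex 0 om *: w) =
    - om *: map_mx (@complex.Im R) w.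
  by apply/rowP => j; rewrite !mxE; case: (w 0 j) => a b /=; rewrite mul0r sub0r mulNr.
have ImZ : map_mx (@complex.Im R) (Complex 0 om *: w) =
    om *: map_mx (@complex.Re R) w.
  by apply/rowP => j; rewrite !mxE; case: (w 0 j) => a b /=; rewrite mul0r add0r.
apply/eigenspaceP/andP => [E|[/eqP E1 /eqP E2]].
  by rewrite -ReM -ImM E ReZ ImZ.
apply/rowP => j; move: E1 E2; rewrite -ReM -ImM -ReZ -ImZ.
move=> /rowP/(_ j); rewrite ![(map_mx _ _) 0 j]mxE => E1.
move=> /rowP/(_ j); rewrite ![(map_mx _ _) 0 j]mxE => E2.
by move: E1 E2; case: (_ 0 j) => a b; case: (_ 0 j) => a' b' /= -> ->.
Qed.

(* The vectors [eD], [eZ], [ew] form a basis in which [M] is a rotation block and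
   a dilation; [nD], [nZ], [nw] are its coordinate forms. *)
Variables (M : 'M[R]_3) (nD nZ nw eD eZ ew : 'rV[R]_3) (o lam : R).
Hypothesis o0 : 0 < o.
Hypothesis lam0 : lam != 0.
Hypothesis frame : forall h, h = dot h nD *: eD + dot h nZ *: eZ + dot h nw *: ew.
Hypothesis eD0 : eD != 0.
Hypothesis ew0 : ew != 0.
Hypothesis dotDw : dot eD nw = 0.
Hypothesis dotZw : dot eZ nw = 0.
Hypothesis dotww : dot ew nw = 1.
Hypothesis MD : eD *m M = eZ.
Hypothesis MZ : eZ *m M = - o *: eD.
Hypothesis Mw : ew *m M = lam *: ew.
Variables (F : 'rV[R]_3 -> 'rV[R]_3) (p : 'rV[R]_3).
Hypothesis JM : 'J F p = M.

Let rotated (om : R) : om != 0 -> om ^+ 2 = o -> forall v, dot v nw = 0 ->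
  exists2 w : 'rV[R[i]]_3, map_mx (@complex.Re R) w = v &
    (w <= eigenspace (jacobianC F p) (Complex 0 om))%MS.
Proof.
move=> om0 omo v vw.
pose y := - om^-1 *: (v *m M).
exists (\row_j Complex (v 0 j) (y 0 j)); first by apply/rowP => j; rewrite !mxE.
rewrite /jacobianC JM eigenspace_imaginary.
have -> : map_mx (@complex.Re R) (\row_j Complex (v 0 j) (y 0 j)) = v.
  by apply/rowP => j; rewrite !mxE.
have -> : map_mx (@complex.Im R) (\row_j Complex (v 0 j) (y 0 j)) = y.
  by apply/rowP => j; rewrite !mxE.
have MM : v *m M *m M = - o *: v.
  rewrite [in LHS](frame v) [in RHS](frame v) vw scale0r addr0.
  rewrite !mulmxDl -!scalemxAl MD MZ -scalemxAl MD scalerDr !scalerA.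
  by rewrite [dot v nZ * _]mulrC [dot v nD * _]mulrC.
apply/andP; split; apply/eqP.
  by rewrite /y scalerA mulrNN divff// scale1r.
by rewrite /y -scalemxAl MM scalerA mulrNN -omo expr2 mulrA mulVf// mul1r.
Qed.

Lemma hopf_point_of_frame : F p = 0 -> hopf_point F p.
Proof.
move=> Fp; split => //; exists (Num.sqrt o), lam.
have s0 : Num.sqrt o != 0 by rewrite gt_eqF// sqrtr_gt0.
have s2 : Num.sqrt o ^+ 2 = o by rewrite sqr_sqrtr// ltW.
have ei om : om != 0 -> om ^+ 2 = o -> eigenvalue (jacobianC F p) (Complex 0 om).
  move=> om0 omo; have [w wE wl] := rotated om0 omo dotDw.
  apply/eigenvalueP; exists w; first exact/eigenspaceP.
  by apply: contra eD0 => /eqP w0; rewrite -wE w0; apply/eqP/rowP => j; rewrite !mxE.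
split => //; [exact: ei|by apply: ei; rewrite ?oppr_eq0// sqrrN|].
apply/eigenvalueP; exists (map_mx (real_complex R) ew).
  rewrite /jacobianC JM -map_mxM Mw; apply/rowP => j; rewrite !mxE.
  exact: rmorphM.
by apply: contra ew0; rewrite map_mx_eq0.
Qed.

(** The form [dot _ nw] is an eigenform of [M] for the real eigenvalue [lam], so
it vanishes on every eigenvector of another eigenvalue; conversely each real
vector it kills is the real part of an eigenvector of [i * sqrt o]. *)
Lemma center_planeE : center_plane F p = [set v | dot v nw = 0].
Proof.
apply/seteqP; split => [v [om [w [om0 wE [s [t ->]]]]]|v /= vw].
  move: wE; rewrite /jacobianC JM eigenspace_imaginary => /andP[/eqP E1 /eqP E2].
  set x := map_mx _ w in E1 E2 *; set y := map_mx (@complex.Im R) w in E1 E2 *.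
  have Mn h : dot (h *m M) nw = lam * dot h nw.
    rewrite {1}(frame h) !mulmxDl -!scalemxAl MD MZ Mw !dotDl !dotZl dotDw dotZw dotww; ring.
  have F1 : lam * dot x nw = - om * dot y nw by rewrite -Mn E1 dotZl.
  have F2 : lam * dot y nw = om * dot x nw by rewrite -Mn E2 dotZl.
  have l2 : lam ^+ 2 + om ^+ 2 != 0.
    by rewrite gt_eqF// addr_gt0// exprn_even_gt0.
  have x0 : dot x nw = 0.
    apply: (mulfI l2); rewrite mulr0 mulrDl expr2 -mulrA F1 expr2 -[om * om * _]mulrA -F2; ring.
  have y0 : dot y nw = 0.
    by apply: (mulfI lam0); rewrite F2 x0 !mulr0.
  by rewrite /= dotDl !dotZl x0 y0 !mulr0 addr0.
have s0 : Num.sqrt o != 0 by rewrite gt_eqF// sqrtr_gt0.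
have s2 : Num.sqrt o ^+ 2 = o by rewrite sqr_sqrtr// ltW.
have [w wE wl] := rotated s0 s2 vw.
exists (Num.sqrt o), w; split => //; exists 1, 0.
by rewrite wE scale1r scale0r addr0.
Qed.

End HopfFrame.

(** * The field and its derivative *)

Section Field.
Variable R : realType.
Implicit Types (p q h : 'rV[R]_3).

Lemma row3E (x y z : R) :
  ((row3 x y z 0 0 = x) * (row3 x y z 0 1 = y) * (row3 x y z 0 2%:R = z))%type.
Proof. by rewrite !mxE. Qed.

Lemma eq_row3 p q : p 0 0 = q 0 0 -> p 0 1 = q 0 1 -> p 0 2%:R = q 0 2%:R -> p = q.
Proof.
move=> h0 h1 h2; apply/rowP => -[[|[|[|//]]] i3].
- by rewrite (_ : Ordinal i3 = 0)//; apply/val_inj.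
- by rewrite (_ : Ordinal i3 = 1)//; apply/val_inj.
- by rewrite (_ : Ordinal i3 = 2%:R)//; apply/val_inj.
Qed.

Lemma norm_le_row3 p (C : R) : `|p 0 0| <= C -> `|p 0 1| <= C -> `|p 0 2%:R| <= C ->
  `|p| <= C.
Proof.
move=> h0 h1 h2; have C0 : 0 <= C by rewrite (le_trans _ h0).
apply: norm_le_coord => // -[[|[|[|//]]] i3].
- by rewrite (_ : Ordinal i3 = 0)//; apply/val_inj.
- by rewrite (_ : Ordinal i3 = 1)//; apply/val_inj.
- by rewrite (_ : Ordinal i3 = 2%:R)//; apply/val_inj.
Qed.

(** Only points at distance less than one are compared, so that the constant may
depend on [x]. *)
Lemma lipschitz_continuous_at (V W : normedModType R) (f : V -> W) x (L : R) :
  (forall y, `|y - x| < 1 -> `|f y - f x| <= L * `|y - x|) -> {for x, continuous f}.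
Proof.
move=> fL; apply/cvgrPdist_le => e e0.
have L1 : 0 < `|L| + 1 by rewrite ltr_wpDl.
apply: (@near_norm _ _ _ (Num.min 1 (e / (`|L| + 1)))).
  by rewrite lt_min ltr01 divr_gt0.
move=> y; rewrite lt_min => /andP[y1]; rewrite ltr_pdivlMr// => ye.
rewrite distrC; apply: le_trans (fL y y1) _; apply: le_trans (ltW ye).
rewrite mulrC ler_wpM2l//; apply: le_trans (ler_norm _) _; lra.
Qed.

Lemma field3_lipschitz (a b c : R) q q' :
  `|field3 a b c q - field3 a b c q'| <=
    (2 * `|a| + `|b| + `|c| + `|q| + `|q'|) * `|q - q'|.
Proof.
have n i := coord_le_norm q i; have n' i := coord_le_norm q' i.
have d i : `|q 0 i - q' 0 i| <= `|q - q'|.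
  by have := coord_le_norm (q - q') i; rewrite !mxE.
have mu (x y r s : R) : `|x| <= r -> `|y| <= s -> `|x * y| <= r * s.
  by move=> ? ?; rewrite normrM ler_pM.
have pr i j : `|q 0 i * q 0 j - q' 0 i * q' 0 j| <= (`|q| + `|q'|) * `|q - q'|.
  have -> : q 0 i * q 0 j - q' 0 i * q' 0 j =
    q 0 i * (q 0 j - q' 0 j) + q' 0 j * (q 0 i - q' 0 i) by ring.
  by apply: le_trans (ler_normD _ _) _; rewrite mulrDl lerD// mu.
have li (x : R) i : `|x * (q 0 i - q' 0 i)| <= `|x| * `|q - q'| by exact: mu.
have b0 := normr_ge0 b; have c0 := normr_ge0 c; have a0 := normr_ge0 a.
have n0 := normr_ge0 (q - q').
have aN := mulr_ge0 a0 n0; have bN := mulr_ge0 b0 n0; have cN := mulr_ge0 c0 n0.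
apply: norm_le_row3; rewrite /field3 !mxE/= !mulrDl.
- have -> : a * (q 0 1 - q 0 0) + q 0 1 * q 0 2 - (a * (q' 0 1 - q' 0 0) + q' 0 1 * q' 0 2)
    = a * (q 0 1 - q' 0 1) - a * (q 0 0 - q' 0 0) + (q 0 1 * q 0 2 - q' 0 1 * q' 0 2) by ring.
  have := ler_normD (a * (q 0 1 - q' 0 1) - a * (q 0 0 - q' 0 0)) (q 0 1 * q 0 2 - q' 0 1 * q' 0 2).
  have := ler_normB (a * (q 0 1 - q' 0 1)) (a * (q 0 0 - q' 0 0)).
  have := li a 1; have := li a 0; have := pr 1 2%:R; rewrite mulrDl => e1 e2 e3 e4 e5.
  lra.
- have -> : b * q 0 0 + c * q 0 1 - q 0 0 * q 0 2 - (b * q' 0 0 + c * q' 0 1 - q' 0 0 * q' 0 2)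
    = b * (q 0 0 - q' 0 0) + c * (q 0 1 - q' 0 1) - (q 0 0 * q 0 2 - q' 0 0 * q' 0 2) by ring.
  have := ler_normB (b * (q 0 0 - q' 0 0) + c * (q 0 1 - q' 0 1)) (q 0 0 * q 0 2 - q' 0 0 * q' 0 2).
  have := ler_normD (b * (q 0 0 - q' 0 0)) (c * (q 0 1 - q' 0 1)).
  have := li b 0; have := li c 1; have := pr 0 2%:R; rewrite mulrDl => e1 e2 e3 e4 e5.
  lra.
- have -> : q 0 0 * q 0 1 + 1 - (q' 0 0 * q' 0 1 + 1) = q 0 0 * q 0 1 - q' 0 0 * q' 0 1 by ring.
  have := pr 0 1; rewrite mulrDl => e1.
  lra.
Qed.

Lemma field3_continuous (a b c : R) : continuous (field3 a b c).
Proof.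
move=> q; apply: (@lipschitz_continuous_at _ _ _ _
  (2 * `|a| + `|b| + `|c| + (`|q| + 1) + `|q|)) => y y1.
apply: le_trans (field3_lipschitz _ _ _ _ _) _; rewrite ler_wpM2r// lerD2r lerD2l.
rewrite -[X in `|X|](subrK q) addrC; apply: le_trans (ler_normD _ _) _.
by rewrite lerD2l ltW.
Qed.

(** The differential acts on row vectors, so the rows are the images of the
basis vectors. *)
Definition jac3 (a b c : R) q : 'M[R]_3 := \matrix_(i < 3)
  [:: row3 (- a) (b - q 0 2%:R) (q 0 1); row3 (a + q 0 2%:R) c (q 0 0);
      row3 (q 0 1) (- q 0 0) 0]`_i.

Lemma mul_jac3 (a b c : R) q h : h *m jac3 a b c q =
  row3 (- a * h 0 0 + (a + q 0 2%:R) * h 0 1 + q 0 1 * h 0 2%:R)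
       ((b - q 0 2%:R) * h 0 0 + c * h 0 1 - q 0 0 * h 0 2%:R)
       (q 0 1 * h 0 0 + q 0 0 * h 0 1).
Proof.
have o1 : lift ord0 ord0 = 1 :> 'I_3 by apply/val_inj.
have o2 : lift ord0 (lift ord0 ord0) = 2%:R :> 'I_3 by apply/val_inj.
by apply: eq_row3; rewrite row3E !mxE !big_ord_recl big_ord0 o1 o2 !mxE /=; ring.
Qed.

(** The remainder of the first-order expansion is a quadratic form, hence
negligible. *)
Lemma jacobian_field3 (a b c : R) q : 'J (field3 a b c) q = jac3 a b c q.
Proof.
have E : 'd (field3 a b c) q = mulmxr (jac3 a b c q) :> ('rV[R]_3 -> 'rV[R]_3).
  apply: diff_unique.
    move=> h; apply: (@lipschitz_continuous_at _ _ _ _ (3 * `|jac3 a b c q|)) => y _.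
    rewrite /= -mulmxBl; apply: norm_le_coord => [|i]; first by rewrite !mulr_ge0.
    rewrite mxE; apply: le_trans (ler_norm_sum _ _ _) _.
    apply: le_trans (_ : \sum_(j < 3) `|jac3 a b c q| * `|y - h| <= _).
      apply: ler_sum => j _; rewrite normrM mulrC ler_pM ?coord_le_norm//.
      rewrite [leRHS]/Num.Def.normr /= mx_normrE.
      exact: (le_bigmax _ (fun ij : 'I_3 * 'I_3 => `|jac3 a b c q ij.1 ij.2|) (j, i)).
    by rewrite sumr_const card_ord -[leLHS]mulr_natl mulrA.
  apply/eqaddoP => e e0.
  apply: (@near_norm R 'rV[R]_3 0 e) => // h; rewrite subr0 => he.
  have -> : (field3 a b c \o shift q - (cst (field3 a b c q) + mulmxr (jac3 a b c q))) h =
     row3 (h 0 1 * h 0 2%:R) (- (h 0 0 * h 0 2%:R)) (h 0 0 * h 0 1).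
    rewrite !fctE /= mul_jac3 /shift.
    by apply: eq_row3; rewrite row3E !mxE /=; ring.
  have m i j : `|h 0 i * h 0 j| <= e * `|h|.
    rewrite normrM ler_pM// ?coord_le_norm//.
    by apply: le_trans (coord_le_norm h i) _; exact: ltW.
  by apply: norm_le_row3; rewrite row3E ?normrN; exact: m.
rewrite /jacobian; apply/row_matrixP => i.
by rewrite !rowE mul_rV_lin1 E.
Qed.

End Field.

(** * The Lyapunov function along orbits *)

Section PowerRule.
Variable R : realType.

Lemma derive_pow (f : R -> R) n (t a : R) : is_derive t 1 f a ->
  is_derive t 1 (fun s => f s ^+ n) (n%:R * f t ^+ n.-1 * a).
Proof.
move=> d; have -> : (fun s => f s ^+ n) = f ^+ n by rewrite exprfctE.
exact: is_deriveX.
Qed.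

End PowerRule.

(** The derivative is found by unification, to be compared afterwards with the
expected one. *)
Ltac derive_poly := first
  [ eassumption | eapply derive_add; derive_poly | eapply derive_sub; derive_poly
  | eapply derive_pow; derive_poly | eapply derive_mul; derive_poly
  | exact: is_derive_cst ].

Section PolynomialCalculus.
Variable R : realType.

Lemma lyap_derive (c al o k40 k31 k13 k04 : R) (D Z w : R -> R) (t D' Z' w' : R) :
  is_derive t 1 D D' -> is_derive t 1 Z Z' -> is_derive t 1 w w' ->
  is_derive t 1 (fun s => lyap c al o k40 k31 k13 k04 (D s) (Z s) (w s))
    (lyapD c al o k40 k31 k13 (D t) (Z t) (w t) * D' +
     lyapZ c al o k31 k13 k04 (D t) (Z t) (w t) * Z' +
     cubicw c al o (D t) (Z t) (w t) * w').
Proof.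
move=> hD hZ hw.
rewrite /lyap /lyapD /lyapZ /cubic /cubicw /cubicD /cubicZ /quarticD /quarticZ.
move: (coef_w c al o) (coef_w2 c o) => G l.
by eapply is_derive_eq; [derive_poly | rewrite /=; field].
Qed.

Lemma lyap_continuous (T : topologicalType) (c al o k40 k31 k13 k04 : R)
    (D Z w : T -> R) (x : T) :
  {for x, continuous D} -> {for x, continuous Z} -> {for x, continuous w} ->
  {for x, continuous (fun y => lyap c al o k40 k31 k13 k04 (D y) (Z y) (w y))}.
Proof.
move=> hD hZ hw; rewrite /lyap /cubic.
have cM (f g : T -> R) : {for x, continuous f} -> {for x, continuous g} ->
    {for x, continuous (fun y => f y * g y)} by exact: cvgM.
have cD (f g : T -> R) : {for x, continuous f} -> {for x, continuous g} ->
    {for x, continuous (fun y => f y + g y)} by exact: cvgD.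
have cN (f : T -> R) : {for x, continuous f} ->
    {for x, continuous (fun y => - f y)} by exact: cvgN.
have cc (a : R) : {for x, continuous (fun _ : T => a)} by exact: cvg_cst.
have cX (f : T -> R) n : {for x, continuous f} -> {for x, continuous (fun y => f y ^+ n)}.
  elim: n => [_|n ih cf]; first exact: cc.
  have -> : (fun y => f y ^+ n.+1) = (fun y => f y * f y ^+ n).
    by apply/funext => y; rewrite exprS.
  by apply: cM => //; exact: ih.
by repeat lazymatch goal with
  | |- {for _, continuous (fun y => _ + _)} => apply cD
  | |- {for _, continuous (fun y => - _)} => apply cN
  | |- {for _, continuous (fun y => _ * _)} => apply cM
  | |- {for _, continuous (fun y => _ ^+ _)} => apply cX
  | |- _ => first [assumption | exact: cc]
  end.
Qed.

End PolynomialCalculus.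

(** * The singular points are foci *)

Section Equilibrium.
Variables (R : realType) (c k : R).
Hypothesis c0 : c != 0.
Hypothesis k1 : 1 < k ^+ 2.

(* Every singular point [(k, y, z)] of the system with [a = - c] has this form:
   [x * y = - 1] gives [y], the first equation then gives [z] and the second one
   [b]. *)
Let b : R := c * (1 + k ^+ 2 + k ^- 2).
Let F := field3 (- c) b c.
Let p : 'rV[R]_3 := row3 k (- k^-1) (c * (1 + k ^+ 2)).
(* [o] is the squared frequency of the rotation, and [al] makes
   [w = S + al * (D + 2 * c * Z)] an eigenform. *)
Let o : R := k ^+ 2 - k ^- 2.
Let al : R := - (k ^+ 2 + k ^- 2) / (o + 4 * c ^+ 2).

(* [dot (q - p) nD = k * (y + k^-1) - (x - k) / k], and [dot (q - p) nw] is [w]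
   with [S = k * (y + k^-1) + (x - k) / k]. *)
Let nD : 'rV[R]_3 := row3 (- k^-1) k 0.
Let nZ : 'rV[R]_3 := row3 0 0 1.
Let nw : 'rV[R]_3 := row3 ((1 - al) / k) ((1 + al) * k) (2 * c * al).

(* The point with coordinates [D], [Z] and [w]. *)
Let pt D Z w : 'rV[R]_3 :=
  row3 (k * (sum_coord c al D Z w - D) / 2) ((sum_coord c al D Z w + D) / (2 * k)) Z.

Let k0 : k != 0.
Proof. by apply: contraTneq k1 => ->; rewrite expr0n/= ltr10. Qed.

Let o0 : 0 < o.
Proof.
rewrite subr_gt0 (lt_trans _ k1)// invf_lt1//; exact: lt_trans k1.
Qed.

Let c2 : 0 < c ^+ 2. Proof. by rewrite exprn_even_gt0. Qed.

Let o4 : o + 4 * c ^+ 2 != 0.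
Proof. by rewrite gt_eqF// addr_gt0// mulr_gt0. Qed.

(* The denominator of [al], cleared of [k ^- 2] in the form that [field] gives it. *)
Let o4' : (k * k) ^+ 2 - 1 + 4 * c ^+ 2 * k ^+ 2 != 0.
Proof.
have k4 : 1 < (k * k) ^+ 2 by rewrite -expr2 exprn_egt1.
have k2 : 0 < k ^+ 2 by exact: lt_trans k1.
rewrite gt_eqF//; apply: addr_gt0; first by rewrite subr_gt0.
by apply: mulr_gt0 k2; apply: mulr_gt0.
Qed.

Let al0 : al != 0.
Proof.
rewrite mulf_neq0 ?invr_eq0// oppr_eq0 gt_eqF// addr_gt0 ?invr_gt0//.
  exact: lt_trans k1.
exact: lt_trans k1.
Qed.

Let dot_pt D Z w : [/\ dot (pt D Z w) nD = D, dot (pt D Z w) nZ = Z & dot (pt D Z w) nw = w].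
Proof.
rewrite !dotE !row3E /sum_coord; split; [by field|by ring|by field].
Qed.

Let pt_dot h : h = pt (dot h nD) (dot h nZ) (dot h nw).
Proof.
rewrite !dotE; apply: eq_row3; rewrite !row3E /sum_coord; [by field|by field|by ring].
Qed.

Let frame h : h = dot h nD *: pt 1 0 0 + dot h nZ *: pt 0 1 0 + dot h nw *: pt 0 0 1.
Proof.
rewrite {1}(pt_dot h); move: (dot h nD) (dot h nZ) (dot h nw) => D Z w.
by apply: eq_row3; rewrite !mxE /= /sum_coord; field.
Qed.

Let pt_neq0 D Z w : (D != 0) || (w != 0) -> pt D Z w != 0.
Proof.
have [d1 _ d3] := dot_pt D Z w; move=> h; apply/eqP => E; move: h.
have z v : dot (0 : 'rV[R]_3) v = 0 by rewrite dotE !mxE !mul0r !addr0.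
have D0 : D = 0 by rewrite -[LHS]d1 E z.
have w0 : w = 0 by rewrite -[LHS]d3 E z.
by rewrite D0 w0 eqxx.
Qed.

Let M := jac3 (- c) b c p.

Let linear_flow D Z w : pt D Z w *m M = pt (- o * Z) D (2 * c * w).
Proof.
rewrite /M mul_jac3 /p !row3E /b.
by apply: eq_row3; rewrite !row3E /sum_coord /al /o; field; rewrite ?k0 ?o4'.
Qed.

Let field_zero : F p = 0.
Proof. by apply: eq_row3; rewrite /F /field3 /p /b !row3E !mxE; field. Qed.

Lemma hopf_point_equilibrium : hopf_point (field3 (- c) b c) p.
Proof.
have [d1 d2 d3] := dot_pt 1 0 0; have [e1 e2 e3] := dot_pt 0 1 0.
have [f1 f2 f3] := dot_pt 0 0 1.
apply: (@hopf_point_of_frame R M nD nZ nw (pt 1 0 0) (pt 0 1 0) (pt 0 0 1) o (2 * c)) => //.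
- by rewrite mulf_neq0.
- by apply: pt_neq0; rewrite oner_eq0.
- by apply: pt_neq0; rewrite oner_eq0 orbT.
- by rewrite linear_flow !mulr0.
- rewrite linear_flow !mulr0 mulr1; by apply: eq_row3; rewrite !mxE /= /sum_coord; field.
- rewrite linear_flow !mulr0 mulr1; by apply: eq_row3; rewrite !mxE /= /sum_coord; field.
- exact: jacobian_field3.
Qed.

Let center_planeEw : center_plane F p = [set v | dot v nw = 0].
Proof.
have [d1 d2 d3] := dot_pt 1 0 0; have [e1 e2 e3] := dot_pt 0 1 0.
have [f1 f2 f3] := dot_pt 0 0 1.
apply: (@center_planeE R M nD nZ nw (pt 1 0 0) (pt 0 1 0) (pt 0 0 1) o (2 * c)) => //.
- by rewrite mulf_neq0.
- by rewrite linear_flow !mulr0.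
- rewrite linear_flow !mulr0 mulr1; by apply: eq_row3; rewrite !mxE /= /sum_coord; field.
- rewrite linear_flow !mulr0 mulr1; by apply: eq_row3; rewrite !mxE /= /sum_coord; field.
- exact: jacobian_field3.
Qed.

Let D_ q := dot (q - p) nD.
Let Z_ q := dot (q - p) nZ.
Let w_ q := dot (q - p) nw.

Let speeds q :
  [/\ dot (F q) nD = speedD c al o (D_ q) (Z_ q) (w_ q),
      dot (F q) nZ = speedZ c al (D_ q) (Z_ q) (w_ q) &
      dot (F q) nw = speedw c al o (D_ q) (Z_ q) (w_ q)].
Proof.
have qE : q = p + pt (D_ q) (Z_ q) (w_ q) by rewrite -pt_dot addrC subrK.
rewrite [in F q]qE; move: (D_ q) (Z_ q) (w_ q) => D Z w.
rewrite !dotE /F /field3 /b /p !mxE /= /speedD /speedZ /speedw /quadw /quadD.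
rewrite /quadZ /coupling /sum_coord /al /o.
by split; field; rewrite ?k0 ?o4'.
Qed.

Lemma dot_frame_bound : exists2 C : R, 1 <= C & forall h,
  [/\ `|dot h nD| <= C * `|h|, `|dot h nZ| <= C * `|h|, `|dot h nw| <= C * `|h| &
      `|h| <= C * (`|dot h nD| + `|dot h nZ| + `|dot h nw|)].
Proof.
pose C1 : R := 3 * (`|nD| + `|nZ| + `|nw|).
pose C2 := `|pt 1 0 0| + `|pt 0 1 0| + `|pt 0 0 1|.
have [a1 a2 a3] : [/\ 0 <= `|nD|, 0 <= `|nZ| & 0 <= `|nw|] by split.
have [b1 b2 b3] : [/\ 0 <= `|pt 1 0 0|, 0 <= `|pt 0 1 0| & 0 <= `|pt 0 0 1|] by split.
have dle h v : `|v| <= `|nD| + `|nZ| + `|nw| -> `|dot h v| <= (1 + C1 + C2) * `|h|.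
  move=> hv; apply: le_trans (dot_le h v) _; rewrite mulrCA mulrC ler_wpM2r//.
  by rewrite /C1 /C2; lra.
exists (1 + C1 + C2); first by rewrite /C1 /C2; lra.
move=> h; split; try by apply: dle; lra.
have le (x : R) e : `|e| <= 1 + C1 + C2 -> `|x *: e| <= (1 + C1 + C2) * `|x|.
  by move=> he; rewrite normrZ mulrC ler_wpM2r.
rewrite {1}(frame h) !mulrDr.
apply: le_trans (ler_normD _ _) _; apply: lerD; last by apply: le; rewrite /C1 /C2; lra.
apply: le_trans (ler_normD _ _) _; apply: lerD; apply: le; rewrite /C1 /C2; lra.
Qed.

(** Inside a thin cone around the tangent plane the quadratic form is comparable
with the squared norm. *)
Lemma cone_coercive : exists b eps : R, [/\ 0 < b, 0 < eps & forall h,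
  `|dot h nw| <= eps * `|h| ->
  b * `|h| ^+ 2 <= dot h nD ^+ 2 + o * dot h nZ ^+ 2].
Proof.
have [C C1 hC] := dot_frame_bound.
have C0 : 0 < C by lra.
pose mo := Num.min 1 o.
have mo0 : 0 < mo by rewrite lt_min ltr01.
exists (mo / (8 * C ^+ 2)), (1 / (2 * C)).
have CC : 0 < 8 * C ^+ 2 by rewrite mulr_gt0// exprn_gt0.
split; [by rewrite divr_gt0|by rewrite divr_gt0// mulr_gt0|].
move=> h hw; have [_ _ _ hh] := hC h.
set D := dot h nD in hh *; set Z := dot h nZ in hh *; set w := dot h nw in hw hh.
have hw' : C * `|w| <= `|h| / 2.
  apply: le_trans (ler_wpM2l (ltW C0) hw) _.
  by rewrite le_eqVlt; apply/orP; left; apply/eqP; field; rewrite gt_eqF.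
have h1 : `|h| <= 2 * C * (`|D| + `|Z|) by rewrite !mulrDr in hh *; lra.
have h2 : `|h| ^+ 2 <= 8 * C ^+ 2 * (D ^+ 2 + Z ^+ 2).
  apply: (@le_trans _ _ ((2 * C * (`|D| + `|Z|)) ^+ 2)).
    by rewrite lerXn2r ?nnegrE// !mulr_ge0 ?addr_ge0// ltW.
  rewrite -[D ^+ 2]real_normK ?num_real// -[Z ^+ 2]real_normK ?num_real//.
  rewrite !exprMn (_ : 2 ^+ 2 * C ^+ 2 * _ = 4 * C ^+ 2 * (`|D| + `|Z|) ^+ 2); last ring.
  rewrite (_ : 8 * C ^+ 2 * _ = 4 * C ^+ 2 * (2 * (`|D| ^+ 2 + `|Z| ^+ 2))); last ring.
  apply: ler_wpM2l; first by rewrite mulr_ge0// exprn_ge0// ltW.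
  by rewrite -subr_ge0 (_ : _ - _ = (`|D| - `|Z|) ^+ 2) ?sqr_ge0//; ring.
rewrite mulrAC ler_pdivrMr//; apply: le_trans (ler_wpM2l (ltW mo0) h2) _.
rewrite mulrCA [leRHS]mulrC ler_pM2l// mulrDr; apply: lerD.
  by rewrite ler_piMl ?sqr_ge0// ge_min lexx.
by rewrite ler_wpM2r ?sqr_ge0// ge_min lexx orbT.
Qed.

(** The Lyapunov function decreases along the orbits on the surface when its
Lyapunov coefficient is negative, and along the reversed orbits otherwise. *)
Lemma focus_equilibrium : focus_on_center_manifold (field3 (- c) b c) p.
Proof.
move=> r W r0 [Wp sW inv TW]; rewrite center_planeEw in TW.
have [f1 f2 f3] := dot_pt 0 0 1.
have [d1 d2 d3] := dot_pt 1 0 0; have [e1 e2 e3] := dot_pt 0 1 0.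
(* The tangent vectors [u] and [v] are the orthogonal projections of [nD] and [nZ],
   so they measure [D] and [Z] up to multiples of [w]. *)
have nww : dot nw nw != 0.
  rewrite dotE -!expr2 gt_eqF// ltr_wpDl ?addr_ge0 ?sqr_ge0//.
  rewrite exprn_even_gt0//= /nw row3E.
  by apply: mulf_neq0 al0; apply: mulf_neq0 c0.
pose kD := dot nD nw / dot nw nw; pose kw := dot nZ nw / dot nw nw.
pose u := nD - kD *: nw; pose v := nZ - kw *: nw.
have Tu : tangent_space W p u.
  by rewrite TW /= /u -scaleN1r dotDl !dotZl /kD divfK// mulN1r subrr.
have Tv : tangent_space W p v.
  by rewrite TW /= /v -scaleN1r dotDl !dotZl /kw divfK// mulN1r subrr.
have du h : dot h u = dot h nD - kD * dot h nw by rewrite dotBr dotZr.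
have dv h : dot h v = dot h nZ - kw * dot h nw by rewrite dotBr dotZr.
have xu : dot (pt 1 0 0) u = 1 by rewrite du d1 d3; ring.
have xv : dot (pt 1 0 0) v = 0 by rewrite dv d2 d3; ring.
have yu : dot (pt 0 1 0) u = 0 by rewrite du e1 e3; ring.
have yv : dot (pt 0 1 0) v = 1 by rewrite dv e2 e3; ring.
have oc : o + c ^+ 2 != 0 by rewrite gt_eqF// addr_gt0.
have [k40 [k31 [k13 [k04 av]]]] := @averaged_rate R c al o (lt0r_neq0 o0) oc.
have [C C1 hC] := dot_frame_bound.
have [b0 [eps0 [b00 eps00 coer]]] := cone_coercive.
have C0 : 0 < C by lra.
pose b1 := b0 / C ^+ 2.
have b10 : 0 < b1 by rewrite divr_gt0// exprn_gt0.
pose L := lyapunov_coef c al o.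
have L0 : 0 < `|L|.
  rewrite normr_gt0 /L /lyapunov_coef; apply: mulf_neq0.
    by apply: mulf_neq0; rewrite ?oppr_eq0 expf_neq0.
  by rewrite invr_eq0; apply: mulf_neq0 oc.
(* Half of the coefficient of [n ^+ 4] in the lower bound that the cone gives for
   [`|L| * (D ^+ 2 + o * Z ^+ 2) ^+ 2]. *)
pose d := `|L| * b1 ^+ 2 / 2.
have d0 : 0 < d by rewrite divr_gt0// mulr_gt0// exprn_gt0.
have [eps [rad [eps_gt0 rad0 est]]] :=
  @lyapunov_estimates R c al o k40 k31 k13 k04 av kD kw b1 d o0 c0 b10 d0.
pose eps' := Num.min eps0 eps.
have eps'0 : 0 < eps' by rewrite lt_min eps00.
have := surface_tangent_cone r0 sW Wp TW f3 eps'0.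
move=> /nbhs_normP[del /= del0 cone].
have [rho0 rho00 clo] := surface_closed_near r0 sW Wp.
pose rho := Num.min rho0 (Num.min (del / 2) (rad / C)).
have rho_gt0 : 0 < rho by rewrite !lt_min rho00 !divr_gt0.
pose V q := lyap c al o k40 k31 k13 k04 (D_ q) (Z_ q) (w_ q).
pose dV q := lyap_rate c al o k40 k31 k13 k04 (D_ q) (Z_ q) (w_ q).
have dVE gamma (t a : R) : is_derive t 1 gamma (a *: F (gamma t)) ->
    is_derive t 1 (V \o gamma) (a * dV (gamma t)).
  move=> dg; have [s1 s2 s3] := speeds (gamma t).
  have h := lyap_derive c al o k40 k31 k13 k04 (dot_derive p nD dg)
     (dot_derive p nZ dg) (dot_derive p nw dg).
  apply: is_derive_eq h _; rewrite !dotZl s1 s2 s3 /dV /lyap_rate.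
  by rewrite /D_ /Z_ /w_; ring.
have cV : continuous V.
  have cd (n q : 'rV[R]_3) : {for q, continuous (fun x : 'rV[R]_3 => dot (x - p) n)}.
    apply: (@lipschitz_continuous_at R _ _ _ q (3 * `|n|)) => y _.
    have -> : dot (y - p) n - dot (q - p) n = dot (y - q) n by rewrite !dotE !mxE; ring.
    by apply: le_trans (dot_le _ _) _; rewrite -mulrA [`|y - q| * _]mulrC.
  by move=> q; apply: lyap_continuous; exact: cd.
pose K := (`|L| * (1 + o) ^+ 2 + d) * C ^+ 4.
have key q : W q -> `|q - p| <= rho ->
    [/\ b1 / 2 * C ^+ 2 * `|q - p| ^+ 2 <= V q,
        V q <= (3 + o) * C ^+ 2 * `|q - p| ^+ 2,
        `|dV q - L * (D_ q ^+ 2 + o * Z_ q ^+ 2) ^+ 2| <= d * C ^+ 4 * `|q - p| ^+ 4,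
        b1 / 2 * C ^+ 2 * `|q - p| ^+ 2 <=
          angular_rate c al o kD kw (D_ q) (Z_ q) (w_ q) &
        b1 ^+ 2 * C ^+ 4 * `|q - p| ^+ 4 <= (D_ q ^+ 2 + o * Z_ q ^+ 2) ^+ 2 <=
        (1 + o) ^+ 2 * C ^+ 4 * `|q - p| ^+ 4].
  rewrite !le_min => Wq /and3P[_ qdel qrad].
  have [nD_ nZ_ nw_ _] := hC (q - p).
  have qcone : `|w_ q| <= eps' * `|q - p|.
    apply: cone => //; rewrite /ball_/= distrC; apply: le_lt_trans qdel _.
    by rewrite ltr_pdivrMr// ltr_pMr// ltr1n.
  have n0 : 0 <= `|q - p| by [].
  have w0 : `|w_ q| <= eps0 * `|q - p|.
    by apply: le_trans qcone _; rewrite ler_wpM2r// ge_min lexx.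
  have w1 : `|w_ q| <= eps * (C * `|q - p|).
    apply: le_trans qcone _; apply: ler_pM => //; first exact: ltW.
      by rewrite ge_min lexx orbT.
    by rewrite ler_peMl.
  have co : b1 * (C * `|q - p|) ^+ 2 <= D_ q ^+ 2 + o * Z_ q ^+ 2.
    rewrite exprMn mulrA /b1 divfK ?expf_neq0 ?gt_eqF//; exact: coer.
  have up : D_ q ^+ 2 + o * Z_ q ^+ 2 <= (1 + o) * (C * `|q - p|) ^+ 2.
    have sq x : `|x| <= C * `|q - p| -> x ^+ 2 <= (C * `|q - p|) ^+ 2.
      by move=> hx; rewrite -(real_normK (num_real x)) lerXn2r ?nnegrE// mulr_ge0// ltW.
    rewrite [leRHS]mulrDl [1 * _]mul1r; apply: lerD; first exact: sq.
    by apply: ler_wpM2l; [exact: ltW|exact: sq].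
  have nr : C * `|q - p| <= rad by rewrite mulrC -ler_pdivlMr.
  have [v1 v2 v3 v4] := est _ _ _ _ nD_ nZ_ nw_ w1 nr co.
  have sqr2 (x : R) : x * C ^+ 2 * `|q - p| ^+ 2 = x * (C * `|q - p|) ^+ 2 by ring.
  have sqr4 (x : R) : x * C ^+ 4 * `|q - p| ^+ 4 = x * (C * `|q - p|) ^+ 4 by ring.
  rewrite !sqr2 (sqr4 d); split => //.
  have pw (x : R) : x ^+ 2 * C ^+ 4 * `|q - p| ^+ 4 = (x * (C * `|q - p|) ^+ 2) ^+ 2 by ring.
  rewrite !pw; apply/andP; split; apply: lerXn2r => //; rewrite ?nnegrE.
  - by rewrite mulr_ge0 ?sqr_ge0// ltW.
  - by rewrite addr_ge0 ?sqr_ge0// mulr_ge0 ?sqr_ge0// ltW.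
  - by rewrite addr_ge0 ?sqr_ge0// mulr_ge0 ?sqr_ge0// ltW.
  - by rewrite mulr_ge0 ?sqr_ge0// addr_ge0// ltW.
have rate sg q : sg * L = - `|L| -> `|sg| = 1 -> W q -> `|q - p| <= rho ->
    - (K * `|q - p| ^+ 4) <= sg * dV q /\ sg * dV q <= - (d * C ^+ 4 * `|q - p| ^+ 4).
  move=> sL s1 Wq qr; have [_ _ k3 _ /andP[k5 k6]] := key q Wq qr.
  move: k3; rewrite -[leLHS]mul1r -s1 -normrM mulrBr mulrA sL.
  set N := (_ + _) ^+ 2 in k5 k6 *; set n4 := `|q - p| ^+ 4 in k5 k6 *.
  have k5' := ler_wpM2l (ltW L0) k5; have k6' := ler_wpM2l (ltW L0) k6.
  rewrite ler_norml => /andP[k7 k8].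
  have dE : `|L| * (b1 ^+ 2 * C ^+ 4 * n4) = 2 * (d * C ^+ 4 * n4).
    by rewrite /d; field.
  have KE : K * n4 = `|L| * ((1 + o) ^+ 2 * C ^+ 4 * n4) + d * C ^+ 4 * n4.
    by rewrite /K; ring.
  by rewrite KE; split; lra.
have ang q : dot (q - p) u * dot (F q) v - dot (q - p) v * dot (F q) u =
    angular_rate c al o kD kw (D_ q) (Z_ q) (w_ q).
  by have [s1 s2 s3] := speeds q; rewrite !du !dv s1 s2 s3.
have C2 : 0 < C ^+ 2 by rewrite exprn_gt0.
have C4 : 0 < C ^+ 4 by rewrite exprn_gt0.
have g1 : 0 < b1 / 2 * C ^+ 2 by rewrite mulr_gt0// divr_gt0.
have g2 : 0 < (3 + o) * C ^+ 2 by rewrite mulr_gt0// addr_gt0.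
have g3 : 0 < d * C ^+ 4 by rewrite mulr_gt0.
have g4 : 0 < K by rewrite mulr_gt0// ltr_wpDl// mulr_ge0// sqr_ge0.
pose Lip := 2 * `|- c| + `|b| + `|c| + (`|p| + rho) + (`|p| + rho).
have Lip0 : 0 <= Lip by rewrite /Lip !addr_ge0 ?mulr_ge0// ltW.
have FL q q' : `|q - p| <= rho -> `|q' - p| <= rho -> `|F q - F q'| <= Lip * `|q - q'|.
  have nb x : `|x - p| <= rho -> `|x| <= `|p| + rho.
    move=> xr; rewrite -[x](subrK p) addrC; apply: le_trans (ler_normD _ _) _.
    by rewrite lerD2l.
  move=> /nb qr /nb q'r; apply: le_trans (field3_lipschitz _ _ _ _ _) _.
  by rewrite ler_wpM2r// /Lip; lra.
have cF : continuous F by exact: field3_continuous.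
have clW := clo rho _; rewrite ge_min lexx in clW; have {}clW := clW isT.
have [Lneg|Lpos] := ltP L 0.
- left; apply: (@attracting_focus_criterion R F p W u v V dV rho _ _ _ _ _ _
    rho_gt0 g1 g2 g3 g4 g1 Lip0 Tu Tv (row_free_dual xu yu xv yv) inv clW cF FL cV).
    move=> gamma t dg; rewrite -[dV _]mul1r; apply: (dVE gamma t 1).
    by rewrite scale1r.
  move=> q Wq qr; have [k1' k2' _ k4' _] := key q Wq qr.
  have sL : 1 * L = - `|L| by rewrite mul1r ltr0_norm// opprK.
  have [l1' l2'] := rate 1 q sL (normr1 _) Wq qr.
  rewrite !mul1r in l1' l2'.
  by split => //; rewrite ang.
- right; apply: (@attracting_focus_criterion R (fun q => - F q) p W v u V (fun q => - dV q) rho _ _ _ _ _ _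
    rho_gt0 g1 g2 g3 g4 g1 Lip0 Tv Tu (row_free_dual yv xv yu xu)
    (locally_invariant_opp inv) clW _ _ cV).
  + move=> q; exact: cvgN (cF q).
  + by move=> q q' h1 h2; rewrite -opprD normrN; exact: FL.
  + move=> gamma t dg; rewrite -mulN1r; apply: (dVE gamma t (-1)).
    by rewrite scaleN1r.
  + move=> q Wq qr; have [k1' k2' _ k4' _] := key q Wq qr.
    have sL : -1 * L = - `|L| by rewrite mulN1r ger0_norm.
    have [l1' l2'] := rate (-1) q sL (normrN1 _) Wq qr.
    rewrite !mulN1r in l1' l2'.
    split => //.
    have Ndot x : dot (- F q) x = - dot (F q) x by rewrite -scaleN1r dotZl mulN1r.
    by rewrite -ang in k4'; rewrite !Ndot !mulrN opprK [leRHS]addrC.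
Qed.

End Equilibrium.

(** * The singular points in terms of the parameters *)

Section SingularPoints.
Variable R : realType.

(** Both families of singular points are covered: [rho] is [sqrt Delta] for
[E4] and [- sqrt Delta] for [E5]. The first coordinate [k] satisfies
[k ^+ 2 = (b - c + rho) / (2 * c)], whose inverse is the same expression with
[- rho]. *)
Lemma singular_point_param (b c rho s : R) : c != 0 -> s ^+ 2 = 1 ->
  rho ^+ 2 = (b - c) ^+ 2 - 4 * c ^+ 2 -> 1 < (b - c + rho) / (2 * c) ->
  exists k : R, [/\ 1 < k ^+ 2, b = c * (1 + k ^+ 2 + k ^- 2) &
    let l := Num.sqrt (- ((- c + b + rho) / - c)) in
    row3 (s * (1 / Num.sqrt 2 * l))
         (- s * ((- c + b - rho) / (2 * Num.sqrt 2 * c) * l))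
         (1 / 2 * (- - c + b + rho)) = row3 k (- k^-1) (c * (1 + k ^+ 2))].
Proof.
move=> c0 s1 hrho; set m := (b - c + rho) / (2 * c) => m1.
have -> : - ((- c + b + rho) / - c) = 2 * m by rewrite /m; field.
have m0 : 0 < m by exact: lt_trans m1.
set l := Num.sqrt (2 * m); set r2 := Num.sqrt 2.
have r20 : r2 != 0 by rewrite gt_eqF// sqrtr_gt0.
have r22 : r2 ^+ 2 = 2 by rewrite sqr_sqrtr.
have l2 : l ^+ 2 = 2 * m by rewrite sqr_sqrtr// mulr_ge0// ltW.
pose k := s * (1 / r2 * l).
have km : k ^+ 2 = m.
  by rewrite /k !exprMn s1 exprVn r22 l2 expr1n; field.
have k0 : k != 0 by apply: contraTneq m0 => k0; rewrite -km k0 expr0n ltxx.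
have mb : m * ((b - c - rho) / (2 * c)) = 1.
  have -> : m * ((b - c - rho) / (2 * c)) = ((b - c) ^+ 2 - rho ^+ 2) / (4 * c ^+ 2).
    by rewrite /m; field.
  by rewrite hrho; field.
have mV : m^-1 = (b - c - rho) / (2 * c).
  by apply: (mulfI (lt0r_neq0 m0)); rewrite divff ?mb// gt_eqF.
have kV : k^-1 = m^-1 * k by rewrite -km; field.
exists k; split.
- by rewrite km.
- by rewrite km mV /m; field.
- rewrite kV km mV /k; congr row3; first by field; rewrite ?c0 ?r20.
  by rewrite /m; field.
Qed.

Lemma Delta_opp (b c : R) : Delta (- c) b c = (b - c) ^+ 2 - 4 * c ^+ 2.
Proof. by rewrite /Delta; ring. Qed.

Lemma E4_param (b c s : R) : 0 < c -> 3 * c < b -> s ^+ 2 = 1 ->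
  exists k : R, [/\ 1 < k ^+ 2, b = c * (1 + k ^+ 2 + k ^- 2) &
    E4 (- c) b c s = row3 k (- k^-1) (c * (1 + k ^+ 2))].
Proof.
move=> c0 bc s1.
have D0 : 0 <= Delta (- c) b c by rewrite Delta_opp; nra.
apply: singular_point_param => //; first by rewrite gt_eqF.
  by rewrite sqr_sqrtr// Delta_opp.
(* [b - c > 2 * c] already without the square root. *)
rewrite ltr_pdivlMr ?mulr_gt0//; have := sqrtr_ge0 (Delta (- c) b c); lra.
Qed.

Lemma E5_param (b c s : R) : c < 0 -> b < 3 * c -> s ^+ 2 = 1 ->
  exists k : R, [/\ 1 < k ^+ 2, b = c * (1 + k ^+ 2 + k ^- 2) &
    E5 (- c) b c s = row3 k (- k^-1) (c * (1 + k ^+ 2))].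
Proof.
move=> c0 bc s1.
have D0 : 0 <= Delta (- c) b c by rewrite Delta_opp; nra.
have [||||k [k1 kb kE]] := @singular_point_param b c (- Num.sqrt (Delta (- c) b c)) s.
- by rewrite lt_eqF.
- by [].
- by rewrite sqrrN sqr_sqrtr// Delta_opp.
- rewrite ltr_ndivlMr ?nmulr_llt0//; have := sqrtr_ge0 (Delta (- c) b c); lra.
by exists k; split => //; move: kE; rewrite /= opprK.
Qed.

End SingularPoints.

Theorem theorem2 (R : realType) (a b c : R) :
  (a = - c -> 0 < c -> 3 * c < b ->
     [/\ hopf_point (field3 a b c) (E4 a b c 1),
         hopf_point (field3 a b c) (E4 a b c (-1)),
         focus_on_center_manifold (field3 a b c) (E4 a b c 1) &
         focus_on_center_manifold (field3 a b c) (E4 a b c (-1))])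
  /\
  (a = - c -> c < 0 -> b < 3 * c ->
     [/\ hopf_point (field3 a b c) (E5 a b c 1),
         hopf_point (field3 a b c) (E5 a b c (-1)),
         focus_on_center_manifold (field3 a b c) (E5 a b c 1) &
         focus_on_center_manifold (field3 a b c) (E5 a b c (-1))]).
Proof.
have N1 : (-1 : R) ^+ 2 = 1 by rewrite sqrrN expr1n.
have P1 : (1 : R) ^+ 2 = 1 by rewrite expr1n.
split=> -> c0 bc.
  have c00 : c != 0 by rewrite gt_eqF.
  have [k [k1 kb ->]] := E4_param c0 bc P1.
  have [k' [k1' kb' ->]] := E4_param c0 bc N1.
  split; [rewrite kb; exact: hopf_point_equilibrium
         |rewrite kb'; exact: hopf_point_equilibrium
         |rewrite kb; exact: focus_equilibrium|rewrite kb'; exact: focus_equilibrium].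
have c00 : c != 0 by rewrite lt_eqF.
have [k [k1 kb ->]] := E5_param c0 bc P1.
have [k' [k1' kb' ->]] := E5_param c0 bc N1.
split; [rewrite kb; exact: hopf_point_equilibrium
       |rewrite kb'; exact: hopf_point_equilibrium
       |rewrite kb; exact: focus_equilibrium|rewrite kb'; exact: focus_equilibrium].
Qed.
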